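(* Let $n>p$ be positive integers with $\gcd(n,p)=1$, and let $P=(x+1)^n-\lambda x^p\in\mathbb{C}(\lambda)[x]$. Then $\mathrm{Gal}(P,\mathbb{C}(\lambda))=S_n$, where $S_n$ is the group of all permutations of $n$ elements (acting on the $n$ roots of $P$).
   Context: $\lambda$ is an indeterminate, $\mathbb{C}(\lambda)$ is the field of rational functions, and $\mathrm{Gal}(P,\mathbb{C}(\lambda))$ is the Galois group of the splitting field of $P$ (as a polynomial in $x$) over $\mathbb{C}(\lambda)$, regarded as a permutation group of the roots of $P$. The integer $p$ is not necessarily prime. *)

(* Defs.v *)
From HB Require Import structures.
From mathcomp Require Import all_boot all_order all_algebra all_fingroup all_field.
From mathcomp Require Import complex reals.
Set Implicit Arguments.
Unset Strict Implicit.
Unset Printing Implicit Defensive.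
Import GRing.Theory.
Local Open Scope ring_scope.
Local Open Scope complex_scope.

(* [{fraction {poly R[i]}}], with R a model of the real numbers, is the field  *)
(* C(lambda): its indeterminate is written lambda, and the ['X] of             *)
(* [trinomial] is the indeterminate x of the polynomials over C(lambda).       *)
Definition lambda (R : realType) : {fraction {poly R[i]}} :=
  tofrac ('X : {poly R[i]}).

Definition trinomial (R : realType) (n p : nat) :
    {poly {fraction {poly R[i]}}} :=
  ('X + 1) ^+ n - lambda R *: 'X^p.

(* [rs] is meant to list, without repetition, the roots in [L] of a polynomial *)
(* with splitting field [L]; [seq_sub rs] is the finite type of these roots.   *)
(* The set below is the image of the Galois group in the symmetric group of    *)
(* the roots: the permutations that are restrictions of automorphisms of [L]   *)
(* over [F].                                                                   *)
Definition Gal_perm (F : fieldType) (L : splittingFieldType F) (rs : seq L) :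
    {set {perm seq_sub rs}} :=
  [set s : {perm seq_sub rs} | [exists g in 'Gal({:L} / 1)%g,
     [forall r : seq_sub rs, g (ssval r) == ssval (s r)]]].

(* Main.v *)
(* Let C be the field of complex numbers, lam the indeterminate, G the Galois
   group.  A root r is transcendental over C, and lam = (r + 1)^n / r^p.

   Transitivity: P has degree 1 in lam, so of two factors of P over C[lam] one
   has its coefficients in C; its roots would be in C, so it has none.

   A transposition: let B be the integral closure of C[lam] in L, and
   phi : B -> C the reduction at a maximal ideal over lam = l0, where l0 is the
   critical value of (x + 1)^n / x^p at its critical point p / (n - p).  The
   reduced polynomial has one double root, all others being simple, so an
   element g <> 1 of G such that phi o g = phi is a transposition of the roots.
   If there were none, the characters phi o g would be independent by
   Dedekind's lemma; with d a square root of the discriminant and e in B such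
   that sum_g sgn(g) phi(g e) <> 0, the element E = sum_g sgn(g) g e would
   satisfy d E, E^2 in C[lam] and phi(E) <> 0, so that d^2 would vanish to even
   order at l0, whereas d^2 = u lam^(n-1) (lam - l0).

   Primitivity: call two roots equivalent if G contains their transposition,
   and let y be the product of s + 1 over the class of r.  It lies in C(r), is
   integral over C[lam] and divides lam up to constants, so it is of the form
   k r^a (r + 1)^i; and the same holds for any root r' <> r of the class.
   Together with lam = (r + 1)^n / r^p this forces a n + p i = 0 (otherwise r'/r
   is a root of unity), hence n | i, and y is k or k lam.  By transitivity y is
   the same for all classes, which, as the product of all s + 1 is lam up to a
   constant, leaves only one class. *)
From HB Require Import structures.
Require Import Defs.
From mathcomp Require Import all_boot all_order all_algebra all_fingroup all_field.
From mathcomp Require Import polyXY ring boolp classical_sets.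
From mathcomp Require Import complex reals.
Import GRing.Theory.
Local Open Scope ring_scope.
Local Open Scope complex_scope.

Set Implicit Arguments.
Unset Strict Implicit.
Unset Printing Implicit Defensive.

Lemma fraction_div (D : idomainType) (x : {fraction D}) :
  exists a b : D, b != 0 /\ x = tofrac a / tofrac b.
Proof.
elim/quotW: x => u; exists u.1, u.2; split; first exact: denom_ratioP.
have d0 := denom_ratioP u.
apply: (mulIf (_ : tofrac u.2 != 0)); first by rewrite tofrac_eq0.
rewrite divfK ?tofrac_eq0 //; unlock FracField.tofrac.
transitivity (\pi_({fraction D})%qT (FracField.mulf u (Ratio u.2 1))).
  exact: (esym (FracField.pi_mul u (Ratio u.2 1))).
apply/eqmodP; rewrite /= FracField.equivfE /FracField.mulf.
by rewrite !numden_Ratio ?mulr1 ?oner_eq0 // mulrC.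
Qed.

(** * Polynomials and rational functions in an element of an extension of C *)

Section Evaluation.

Variables (C : closedFieldType) (K : fieldType) (c : {rmorphism C -> K}).
Implicit Types (x y : K) (a b h : {poly C}).

(** Evaluation is packaged as a ring morphism, so that polynomial identities can be checked in [K]
    and pulled back by [ev_inj]. *)
Definition ev x : {rmorphism {poly C} -> K} :=
  horner_morph (fun k => mulrC x (c k)).

Arguments ev : simpl never.

Lemma evX x : ev x 'X = x. Proof. exact: horner_morphX. Qed.

Lemma evC x k : ev x k%:P = c k. Proof. exact: horner_morphC. Qed.

Lemma evE x a : ev x a = (map_poly c a).[x]. Proof. by []. Qed.

(** [C] is algebraically closed, so [a] splits into linear factors, one of which vanishes at [x].
    Hence transcendence can be stated as [forall k, x <> c k]. *)
Lemma closed_root x a : a != 0 -> ev x a = 0 -> exists k, x = c k.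
Proof.
have [s ->] := closed_field_poly_normal a.
rewrite -mul_polyC mulf_eq0 negb_or polyC_eq0 => /andP[a0 _] /eqP.
rewrite rmorphM evC /= mulf_eq0 fmorph_eq0 (negPf a0) /= rmorph_prod.
rewrite prodf_seq_eq0 => /hasP[k _ /=]; rewrite rmorphB evX evC subr_eq0.
by move/eqP=> ->; exists k.
Qed.

Lemma ev_eq0 x a : (forall k, x <> c k) -> (ev x a == 0) = (a == 0).
Proof.
move=> trx; have [->|a0] := eqVneq a 0; first by rewrite rmorph0 eqxx.
by apply/negP=> /eqP /(closed_root a0)[k /trx].
Qed.

Lemma ev_inj x : (forall k, x <> c k) -> injective (ev x).
Proof.
move=> trx a b /eqP; rewrite -subr_eq0 -rmorphB ev_eq0 // subr_eq0.
by move/eqP.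
Qed.

(** Membership of [y] in the field C(x), with the denominator cleared. *)
Definition ratfun x y := exists a b, b != 0 /\ ev x b * y = ev x a.

Section Transcendental.
Variable x : K.
Hypothesis trx : forall k, x <> c k.

Lemma ratfun_ev a : ratfun x (ev x a).
Proof. by exists a, 1; rewrite oner_eq0 rmorph1 mul1r. Qed.

Lemma ratfunD y z : ratfun x y -> ratfun x z -> ratfun x (y + z).
Proof.
move=> [a [b [b0 e]]] [a' [b' [b'0 e']]].
exists (a * b' + a' * b), (b * b'); rewrite mulf_neq0 //; split=> //.
by rewrite rmorphD !rmorphM -e -e' /=; ring.
Qed.

Lemma ratfunM y z : ratfun x y -> ratfun x z -> ratfun x (y * z).
Proof.
move=> [a [b [b0 e]]] [a' [b' [b'0 e']]].
exists (a * a'), (b * b'); rewrite mulf_neq0 //; split=> //.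
by rewrite !rmorphM -e -e' /=; ring.
Qed.

Lemma ratfunV y : ratfun x y -> ratfun x y^-1.
Proof.
have [->|y0] := eqVneq y 0; first by rewrite invr0.
move=> [a [b [b0 e]]]; exists b, a; rewrite -(ev_eq0 a trx) -e.
by rewrite mulf_neq0 ?ev_eq0 // mulfK.
Qed.

Lemma ratfun_horner (q : {poly K}) y :
  (forall i, ratfun x q`_i) -> ratfun x y -> ratfun x q.[y].
Proof.
move=> rq ry; rewrite horner_coef; elim/big_ind: _ => [||i _].
- by rewrite -(rmorph0 (ev x)); apply: ratfun_ev.
- exact: ratfunD.
- apply: ratfunM => //; elim: (nat_of_ord i) => [|m IH].
    by rewrite expr0 -(rmorph1 (ev x)); apply: ratfun_ev.
  by rewrite exprS; apply: ratfunM.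
Qed.

Lemma ratfun_coprime y :
  ratfun x y -> exists a b, [/\ b != 0, coprimep a b & ev x b * y = ev x a].
Proof.
move=> [a [b [b0 e]]]; exists (a %/ gcdp a b), (b %/ gcdp a b).
have g0 : gcdp a b != 0 by rewrite gcdp_eq0 negb_and b0 orbT.
split; first by rewrite dvdp_div_eq0 ?dvdp_gcdr.
- by rewrite coprimep_div_gcd // b0 orbT.
apply: (mulfI (_ : ev x (gcdp a b) != 0)); first by rewrite ev_eq0.
rewrite mulrA -!rmorphM ![gcdp a b * _]mulrC !divpK ?dvdp_gcdr ?dvdp_gcdl //.
Qed.

(* Rational root theorem, in [C[x]]. *)
Lemma rational_root_denom (q : {poly K}) y a b h :
    q \is monic -> root q y -> b != 0 -> coprimep a b -> ev x b * y = ev x a ->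
    (forall i, exists a', ev x h * q`_i = ev x a') -> b %| h.
Proof.
move=> mq /rootP qy b0 cab e /choice[f fE].
have q0 := monic_neq0 mq; pose d := (size q).-1.
have sq : size q = d.+1 by rewrite polySpred.
(* The equation [q.[y] = 0] times [h b^d]: the leading term becomes [h a^d], and every other term
   keeps a factor [b]. *)
have key : h * a ^+ d = - b * (\sum_(i < d) f i * a ^+ i * b ^+ (d - i.+1)).
  apply: (ev_inj trx); apply/eqP; rewrite -subr_eq0.
  rewrite !rmorphM rmorphN mulNr opprK rmorph_sum /= mulr_sumr.
  move/(congr1 (fun z => ev x h * ev x b ^+ d * z)): qy.
  rewrite mulr0 horner_coef sq big_ord_recr /= mulrDr => qy.
  have lq : q`_d = 1 by have /eqP := mq; rewrite lead_coefE.
  rewrite lq mul1r rmorphXn -e exprMn mulrA addrC in qy *.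
  rewrite -[X in _ == X]qy; apply/eqP; congr (_ + _); rewrite mulr_sumr.
  apply: eq_bigr => i _; rewrite !rmorphM -fE !rmorphXn /= -e.
  have -> : ev x b ^+ d = ev x b ^+ (d - i.+1) * ev x b ^+ i * ev x b.
    by rewrite -exprD -exprSr -addnS subnK.
  by rewrite exprMn; ring.
have : b %| h * a ^+ d by rewrite key mulNr dvdpNr dvdp_mulr.
by rewrite mulrC Gauss_dvdpr // coprimep_sym coprimep_expl.
Qed.

End Transcendental.
End Evaluation.

(** * Auxiliary results on polynomials, characters and discriminants *)

Lemma deriv_prod_XsubC_root (R : comNzRingType) (s : seq R) z : z \in s ->
  (\prod_(x <- s) ('X - x%:P))^`().[z] = \prod_(x <- rem z s) (z - x).
Proof.
move=> zs; rewrite (perm_big _ (perm_to_rem zs)) big_cons derivM derivXsubC.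
rewrite mul1r hornerD hornerM hornerXsubC subrr mul0r addr0 horner_prod.
by apply: eq_bigr => x _; rewrite hornerXsubC.
Qed.

(** An entry listed twice survives one removal and makes the derivative vanish. *)
Lemma uniq_simple_roots (R : idomainType) (s : seq R) :
  (forall z, z \in s -> (\prod_(x <- s) ('X - x%:P))^`().[z] != 0) -> uniq s.
Proof.
move=> nz; apply: count_mem_uniq => z; case zs: (z \in s); last first.
  exact/count_memPn/negbT.
rewrite (seq.permP (perm_to_rem zs)) /= eqxx; congr (_.+1); apply/count_memPn.
have := nz z zs; rewrite deriv_prod_XsubC_root //; apply: contra => zr.
by rewrite (perm_big _ (perm_to_rem zr)) big_cons subrr /= mul0r.
Qed.

(** Exchanging the variables shows that the trinomial has degree 1 in lambda. *)
Lemma swapXY_trinomial (R : comNzRingType) (n p : nat) :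
  swapXY (('X + 1) ^+ n - ('X : {poly R}) *: 'X^p) =
  (('X + 1) ^+ n)%:P - ('X^p)%:P * 'X.
Proof.
apply: (inv_inj swapXYK); rewrite swapXYK raddfB /=.
rewrite (swapXY_is_monoid_morphism _).2 /= !swapXY_polyC (swapXY_X R).
rewrite map_polyXn mulrC mul_polyC rmorphXn rmorphD /=.
by rewrite map_polyX rmorph1.
Qed.

(** Otherwise the nonzero difference would have as many distinct roots 0, 1, 2, ... as its size, one
    too many. *)
Lemma poly_horner_inj (R : numDomainType) (a b : {poly R}) :
  (forall k, a.[k] = b.[k]) -> a = b.
Proof.
move=> eab; apply/eqP; rewrite -subr_eq0; apply/negPn/negP => d0.
have := max_poly_roots (rs := [seq i%:R | i <- iota 0 (size (a - b))]) d0.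
rewrite size_map size_iota ltnn => h; suff: false by []; apply: h.
  by apply/allP => k _; rewrite rootE hornerD hornerN eab subrr.
by rewrite map_inj_uniq ?iota_uniq //; apply: Num.Theory.mulrIn;
  rewrite oner_eq0.
Qed.

(* Dedekind's lemma, for characters of a multiplicative monoid. *)
Lemma character_independence (R : nzRingType) (C : idomainType) (T : eqType)
    (M : {pred R}) (chi : T -> R -> C) (ts : seq T) :
    1 \in M -> {in M &, forall x y, x * y \in M} -> uniq ts ->
    {in ts, forall t, chi t 1 = 1} ->
    {in ts, forall t, {in M &, {morph chi t : x y / x * y}}} ->
    {in ts &, forall s t, s != t -> exists2 x, x \in M & chi s x != chi t x} ->
  forall a, (forall x, x \in M -> \sum_(t <- ts) a t * chi t x = 0) ->
  {in ts, forall t, a t = 0}.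
Proof.
move=> M1 MM; elim: ts => [|s ts IH] //= /andP[sts uts] chi1 chiM chiD a sum0.
have a0 : {in ts, forall t, a t = 0}.
  move=> t tts; have st : s != t by apply: contraNneq sts => ->.
  have [||z zM dz] := chiD s t _ _ st; rewrite ?mem_head ?in_cons ?tts ?orbT //.
  (* Subtracting [chi s z] times the relation at [x] from the relation at [z * x] eliminates [s] and
     leaves a shorter relation with these coefficients. *)
  suff /(_ t tts)/eqP : {in ts, forall t, a t * (chi t z - chi s z) = 0}.
    by rewrite mulf_eq0 subr_eq0 => /orP[/eqP // | /eqP e];
      rewrite e eqxx in dz.
  apply: IH => // [t' h|t' h|t1 t2 h1 h2|x xM].
  - by apply: chi1; rewrite in_cons h orbT.
  - by apply: chiM; rewrite in_cons h orbT.
  - by apply: chiD; rewrite in_cons ?h1 ?h2 orbT.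
  have := sum0 _ (MM _ _ zM xM); have /(congr1 ( *%R (chi s z))) := sum0 _ xM.
  rewrite !big_cons mulr0 chiM ?mem_head // => e1 e2.
  have : (a s * (chi s z * chi s x) + \sum_(j <- ts) a j * chi j (z * x)) -
    chi s z * (a s * chi s x + \sum_(j <- ts) a j * chi j x) = 0.
    by rewrite e1 e2 subr0.
  rewrite mulrDr opprD addrACA [X in X + _](_ : _ = 0); last by ring.
  rewrite add0r mulr_sumr -sumrB => e3; rewrite -[RHS]e3 big_seq [RHS]big_seq.
  apply: eq_bigr => j jts; rewrite chiM ?in_cons ?jts ?orbT //; ring.
move=> t; rewrite in_cons => /orP[/eqP->|/a0 //].
have := sum0 _ M1;
  rewrite big_cons chi1 ?mem_head // mulr1 big_seq big1 ?addr0 //.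
by move=> j /a0 ->; rewrite mul0r.
Qed.

(** Each pair of indices occurs in both orders on the left, whence the square and the sign [u].
    Applied to roots, the left side is the product of the derivatives, so this provides a square
    root of the discriminant. *)
Lemma prod_diff_sqr (R : comNzRingType) (n : nat) (r : 'I_n -> R) :
  exists2 u : int, u ^+ 2 = 1 & \prod_i \prod_(j < n | j != i) (r i - r j) =
    u%:~R * (\prod_(i < n) \prod_(j < n | (i < j)%N) (r i - r j)) ^+ 2.
Proof.
exists (\prod_(i < n) \prod_(j < n | (i < j)%N) -1).
  by rewrite -prodrXl big1 // => i _; rewrite -prodrXl big1.
have split_i i : \prod_(j < n | j != i) (r i - r j) =
    \prod_(j < n | (i < j)%N) (r i - r j) *
    \prod_(j < n | (j < i)%N) (r i - r j).
  rewrite (bigID (fun j : 'I_n => (i < j)%N)) /=; congr (_ * _).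
    by apply: eq_bigl => j; rewrite -val_eqE /=; case: ltngtP.
  by apply: eq_bigl => j; rewrite -val_eqE /=; case: ltngtP.
rewrite (eq_bigr _ (fun i _ => split_i i)) big_split /= expr2 mulrCA.
congr (_ * _); rewrite (exchange_big_dep predT) //= rmorph_prod -big_split.
apply: eq_bigr => i _ /=; rewrite rmorph_prod -big_split.
by apply: eq_bigr => j _; rewrite /= rmorphN1 mulN1r opprB.
Qed.

(** The factors [a] and [a ^+ 2] avoid the exponents m - 1 and m - 2, so that small [m] is no
    exception. *)
Lemma horner_deriv_Xn (R : comNzRingType) m (a : R) :
  ('X^m)^`().[a] * a = m%:R * a ^+ m /\
  ('X^m)^`()^`().[a] * a ^+ 2 = m%:R * (m%:R - 1) * a ^+ m.
Proof.
rewrite derivXn derivMn derivXn !hornerMn !hornerXn.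
case: m => [|[|m]] /=;
  rewrite ?mulr0n ?mul0r ?expr0 ?mulr1n ?subrr ?mulr0 ?mul0r //.
split; first by rewrite -mulr_natl [a ^+ m.+2]exprSr mulrA.
rewrite -[_ *+ m.+1 *+ _]mulr_natl -[_ *+ m.+1]mulr_natl -addn2 exprD natrD
  -[m.+1]addn1 natrD.
by ring.
Qed.

Lemma horner_deriv_Xadd1n (R : comNzRingType) m (a : R) :
  (('X + 1) ^+ m)^`().[a] * (a + 1) = m%:R * (a + 1) ^+ m /\
  (('X + 1) ^+ m)^`()^`().[a] * (a + 1) ^+ 2 = m%:R * (m%:R - 1) * (a + 1) ^+ m.
Proof.
have -> : ('X + 1) ^+ m = 'X^m \Po ('X + 1) :> {poly R}.
  by rewrite comp_Xn_poly.
have d : ('X + 1 : {poly R})^`() = 1 by rewrite derivD derivX derivC addr0.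
have h : ('X + 1).[a] = a + 1 by rewrite !hornerE.
rewrite !deriv_comp d !mulr1 deriv_comp d mulr1 !horner_comp h.
exact: horner_deriv_Xn.
Qed.

Lemma deriv_exp_XsubC_mul (R : comNzRingType) (a : R) m (q : {poly R}) :
  (('X - a%:P) ^+ m.+1 * q)^`() =
  ('X - a%:P) ^+ m * (q *+ m.+1 + ('X - a%:P) * q^`()).
Proof.
rewrite derivM deriv_exp derivXsubC mul1r /= exprS mulrDr.
rewrite mulrnAl mulrnAr mulrA; congr (_ + _).
by rewrite [_ ^+ m * _]mulrC.
Qed.

(** * The integral closure of C[lambda] in L *)

Section Trinomial.

Variables (C : numClosedFieldType) (n p : nat).
Hypotheses (p_gt0 : (0 < p)%N) (p_lt_n : (p < n)%N) (coprime_np : coprime n p).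
Variable L : splittingFieldType {fraction {poly C}}.

Definition cst : {rmorphism C -> L} :=
  in_alg L \o (@tofrac {poly C}) \o polyC.
Arguments cst : simpl never.
Definition lam : L := in_alg L (tofrac 'X).
(** An evaluation, so that the results on [ev] apply to [lam]; [embE] identifies it with the
    structural embedding of C[lambda]. *)
Definition emb : {rmorphism {poly C} -> L} := ev cst lam.
Arguments emb : simpl never.

Lemma embX : emb 'X = lam. Proof. exact: evX. Qed.

Lemma embC k : emb k%:P = cst k. Proof. exact: evC. Qed.

Lemma embE (a : {poly C}) : emb a = in_alg L (tofrac a).
Proof.
elim/poly_ind: a => [|a k IH]; first by rewrite !rmorph0.
by rewrite !rmorphD !rmorphM /= IH /emb evX evC.
Qed.

Lemma lam_trans k : lam <> cst k.
Proof.
move=> /fmorph_inj/eqP; rewrite tofrac_eq => /eqP /(congr1 (size \o val)).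
by rewrite /= size_polyX size_polyC; case: eqP.
Qed.

Lemma mem1P (x : L) : reflect (ratfun cst lam x) (x \in 1%AS).
Proof.
apply: (iffP idP) => [/vlineP[u ->]|[a [b [b0 e]]]].
  have [a [b [b0 ->]]] := fraction_div u; exists a, b; split=> //.
  rewrite -!/emb !embE -!in_algE -rmorphM /= mulrC divfK ?tofrac_eq0 //.
have ib0 : emb b != 0 by rewrite ev_eq0 //; apply: lam_trans.
have -> : x = (emb b)^-1 * emb a by rewrite -e mulKf.
by rewrite rpredM ?rpredV // embE rpredZ ?rpred1.
Qed.

(** The ring B of the elements integral over C[lambda], made boolean so that it can carry a subring
    structure. *)
Definition Bint : {pred L} := fun x => `[<integralOver emb x>].

Lemma BintP x : reflect (integralOver emb x) (x \in Bint).
Proof. exact: asboolP. Qed.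

Fact Bint_subring : subring_closed Bint.
Proof.
split=> [|x y /BintP ix /BintP iy|x y /BintP ix /BintP iy]; apply/BintP.
- exact: integral1.
- exact: integral_sub.
- exact: integral_mul.
Qed.
HB.instance Definition _ := GRing.isSubringClosed.Build L Bint Bint_subring.

Lemma Bint_emb a : emb a \in Bint.
Proof. exact/BintP/integral_id. Qed.

Lemma Bint_cst k : cst k \in Bint.
Proof. by rewrite -(evC cst lam) Bint_emb. Qed.

Lemma Bint_lam : lam \in Bint.
Proof. by rewrite -[lam](evX cst) Bint_emb. Qed.

(** C[lambda] is integrally closed: by the rational root theorem with [h = 1] the denominator is a
    unit. *)
Lemma Bint_mem1 x : x \in Bint -> x \in 1%AS -> exists a, x = emb a.
Proof.
move=> /BintP[q mq rq] /mem1P/(ratfun_coprime lam_trans)[a [b [b0 cab e]]].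
have: b %| 1.
  apply: (rational_root_denom lam_trans (monic_map _ mq) rq b0 cab e) => i.
  by rewrite coef_map rmorph1 mul1r; exists q`_i.
rewrite dvdp1 => /size_poly1P[k k0 bE].
exists (k^-1 *: a); rewrite -mul_polyC rmorphM -e mulrA -rmorphM bE.
by rewrite -polyCM mulVf // rmorph1 mul1r.
Qed.

Lemma cst_mem1 k : cst k \in 1%AS.
Proof. by rewrite rpredZ ?rpred1. Qed.

(* Otherwise [rmorphM] and [field] split [cst] into its three components. *)
#[local] Opaque cst.

Lemma lam_mem1 : lam \in 1%AS.
Proof. by rewrite rpredZ ?rpred1. Qed.

Lemma emb_mem1 a : emb a \in 1%AS.
Proof. by rewrite embE rpredZ ?rpred1. Qed.

(** In case of equality [b] would lie in C(lambda), hence in C[lambda], and evaluation at [k] would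
    give [l = 0]. This makes the ideal generated by [lam - cst k] in B proper. *)
Lemma lam_cst_nonunit k l b : b \in Bint -> l != 0 ->
  (lam - cst k) * b != cst l.
Proof.
move=> Bb l0; apply/eqP=> e.
have d0 : lam - cst k != 0 by rewrite subr_eq0; apply/eqP/lam_trans.
have [|a aE] := Bint_mem1 Bb.
  have -> : b = (lam - cst k)^-1 * cst l by rewrite -e mulKf.
  by rewrite rpredM ?rpredV ?rpredB ?cst_mem1 ?lam_mem1.
have : emb (('X - k%:P) * a) = emb l%:P.
  by rewrite rmorphM rmorphB /emb evX !evC -/emb -aE.
move/(ev_inj lam_trans)/(congr1 (horner^~ k)).
by rewrite !hornerE subrr mul0r => /esym/eqP; rewrite (negPf l0).
Qed.

Definition Ptri : {poly L} := ('X + 1) ^+ n - lam *: 'X^p.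

Lemma Ptri_map :
  map_poly (in_alg L) (('X + 1) ^+ n - tofrac ('X : {poly C}) *: 'X^p) = Ptri.
Proof.
rewrite rmorphB /= map_polyZ /= rmorphXn rmorphD /= rmorph1.
by rewrite map_polyX map_polyXn.
Qed.

Lemma horner_Ptri x : Ptri.[x] = (x + 1) ^+ n - lam * x ^+ p.
Proof. by rewrite !hornerE. Qed.

Lemma size_Xadd1n (R : nzRingType) : size (('X + 1 : {poly R}) ^+ n) = n.+1.
Proof.
have -> : 'X + 1 = 'X - (-1)%:P :> {poly R} by rewrite polyCN opprK.
by rewrite size_exp_XsubC.
Qed.

Lemma size_Ptri : size Ptri = n.+1.
Proof.
rewrite size_polyDl size_Xadd1n // size_polyN.
by rewrite (leq_ltn_trans (size_scale_leq _ _)) // size_polyXn.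
Qed.

Lemma monic_Ptri : Ptri \is monic.
Proof.
rewrite monicE lead_coefDl; last first.
  rewrite size_Xadd1n size_polyN.
  by rewrite (leq_ltn_trans (size_scale_leq _ _)) // size_polyXn.
by rewrite lead_coef_exp lead_coefDl ?lead_coefX ?expr1n // size_polyX
  size_poly1.
Qed.

Lemma n_gt0 : (0 < n)%N. Proof. exact: leq_ltn_trans p_lt_n. Qed.

Section Root.
Variable r : L.
Hypothesis Pr : root Ptri r.

Lemma root_eqn : (r + 1) ^+ n = lam * r ^+ p.
Proof. by move/rootP/eqP: Pr; rewrite horner_Ptri subr_eq0 => /eqP. Qed.

(** A constant root [k] is nonzero and would make [lam] the constant [(k + 1)^n / k^p]. *)
Lemma root_trans k : r <> cst k.
Proof.
move=> rE; have := root_eqn; rewrite rE.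
have [->|k0] := eqVneq k 0.
  rewrite rmorph0 add0r expr1n expr0n (gtn_eqF p_gt0) mulr0.
  by move/eqP; rewrite oner_eq0.
rewrite -(rmorph1 cst) -rmorphD -!rmorphXn => e.
apply: (@lam_trans ((k + 1) ^+ n / k ^+ p)).
by rewrite rmorphM fmorphV e mulfK // fmorph_eq0 expf_neq0.
Qed.

Lemma root_neq0 : r != 0.
Proof. by apply/eqP=> r0; apply: (@root_trans 0); rewrite rmorph0. Qed.

Lemma root_add1_neq0 : r + 1 != 0.
Proof.
by rewrite addr_eq0; apply/eqP=> r0; apply: (@root_trans (-1));
  rewrite rmorphN1.
Qed.

Lemma Bint_root : r \in Bint.
Proof.
apply/BintP/(integral_root_monic monic_Ptri Pr)/integral_poly => i.
apply/BintP; rewrite coefB coefZ coefXn.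
rewrite rpredB ?rpredM ?Bint_lam ?rpred_nat //.
suff /polyOverP : ('X + 1 : {poly L}) ^+ n \is a polyOver Bint by apply.
by rewrite rpredX // rpredD ?polyOverX // rpred1.
Qed.

(** Eliminating [lam] by the root equation exposes the critical points -1 and [p / (n - p)] of
    [(x + 1)^n / x^p]. *)
Lemma deriv_Ptri_root :
  Ptri^`().[r] * r = (r + 1) ^+ n.-1 * ((n - p)%:R * r - p%:R).
Proof.
have -> : Ptri^`().[r] = n%:R * (r + 1) ^+ n.-1 - lam * (p%:R * r ^+ p.-1).
  rewrite derivB derivZ derivXn deriv_exp derivD derivX derivC addr0 mul1r.
  rewrite hornerD hornerN hornerZ !hornerMn hornerXn horner_exp !hornerE.
  by rewrite -mulr_natl -[r ^+ p.-1 *+ p]mulr_natl mulrA.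
have en : (r + 1) ^+ n = (r + 1) ^+ n.-1 * (r + 1)
  by rewrite -exprSr prednK ?n_gt0.
have ep : r ^+ p = r ^+ p.-1 * r by rewrite -exprSr prednK.
have := root_eqn; rewrite en ep => e.
rewrite natrB ?(ltnW p_lt_n) //.
transitivity (n%:R * (r + 1) ^+ n.-1 * r - p%:R * (lam * (r ^+ p.-1 * r))).
  by ring.
by rewrite -e; ring.
Qed.

End Root.

(** * Reduction at a maximal ideal *)

Section Residue.

Variable l0 : C.

Definition proper_ideal (m : set L) :=
  [/\ forall x, m x -> x \in Bint, m (lam - cst l0), ~ m 1,
      forall x y, m x -> m y -> m (x + y) &
      forall x y, x \in Bint -> m y -> m (x * y)].

(** Zorn's lemma, started from the multiples of [lam - cst l0]. Maximality is stated as
    invertibility modulo [m]. *)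
Lemma maximal_ideal : exists2 m, proper_ideal m &
  forall b, b \in Bint -> ~ m b -> exists2 x, x \in Bint & m (1 - x * b).
Proof.
have Bl0 : lam - cst l0 \in Bint by rewrite rpredB ?Bint_lam ?Bint_cst.
pose m0 : set L :=
  [set x | exists2 b, b \in Bint & x = b * (lam - cst l0)]%classic.
have m0P : proper_ideal m0.
  split.
  - by move=> x [b bB ->]; rewrite rpredM.
  - by exists 1; rewrite ?rpred1 ?mul1r.
  - move=> [b bB /esym/eqP]; apply/negP; rewrite mulrC -(rmorph1 cst).
    by rewrite lam_cst_nonunit ?oner_eq0.
  - move=> _ _ [b bB ->] [b' b'B ->]; exists (b + b'); rewrite ?rpredD //.
    by rewrite mulrDl.
  - by move=> x _ xB [b bB ->]; exists (x * b); rewrite ?rpredM ?mulrA.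
pose PZ : set (set L) := [set m | m = set0 \/ proper_ideal m]%classic.
have PZP X x : PZ X -> X x -> proper_ideal X by case=> [->|].
have [F FP Ftot|m [mP mmax]] := @Zorn_bigcup L PZ.
  have [[X0 [FX0 [x0 X0x0]]]|noX] := pselect (exists X, F X /\ exists x, X x);
    last first.
    left; apply/seteqP; split=> // x [X FX Xx].
    by apply: noX; exists X; split=> //; exists x.
  right; split.
  - by move=> x [X /FP/PZP XP Xx]; have [h _ _ _ _] := XP _ Xx; apply: h.
  - by exists X0 => //; have [] := PZP _ _ (FP _ FX0) X0x0.
  - by move=> [X /FP/PZP XP X1]; have [_ _ h _ _] := XP _ X1; apply: h.
  - move=> x y [X FX Xx] [Y FY Yy].
    have [XY|YX] := Ftot _ _ FX FY.
      exists Y => //; have [_ _ _ h _] := PZP _ _ (FP _ FY) Yy.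
      by apply: h => //; apply: XY.
    exists X => //; have [_ _ _ h _] := PZP _ _ (FP _ FX) Xx.
    by apply: h => //; apply: YX.
  - move=> x y xB [Y FY Yy]; exists Y => //.
    by have [_ _ _ _ h] := PZP _ _ (FP _ FY) Yy; apply: h.
have {mP} mP : proper_ideal m.
  case: mP => // mE; have [] := mmax m0 _ _; last by right.
  rewrite mE; split; first exact: sub0set.
  by move=> /(_ (lam - cst l0)) []; have [] := m0P.
exists m => // b bB nmb.
have [mB ml m1 mD mM] := mP.
(* The ideal generated by [m] and [b]; by maximality it contains 1. *)
pose m' : set L :=
  [set z | exists x y, [/\ x \in Bint, m y & z = x * b + y]]%classic.
have m0' : m 0 by rewrite -(mul0r (lam - cst l0)); apply: mM; rewrite ?rpred0.
have [[x [y [xB my e]]]|nm'] := pselect (m' 1).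
  by exists x => //; rewrite e addrC addKr.
have mm' : (m `<=` m')%classic.
  by move=> y my; exists 0, y; rewrite rpred0 mul0r add0r.
have [] := mmax m' _ _.
  split=> // /(_ b) h; apply/nmb/h; exists 1, 0; split; rewrite ?rpred1 //.
  by rewrite mul1r addr0.
right; split=> //.
- by move=> _ [x [y [xB my ->]]]; rewrite rpredD ?rpredM //; apply: mB.
- exact: mm'.
- move=> _ _ [x [y [xB my ->]]] [x' [y' [x'B my' ->]]].
  exists (x + x'), (y + y'); split; [by rewrite rpredD|exact: mD|by ring].
- move=> z _ zB [x [y [xB my ->]]]; exists (z * x), (z * y).
  by split; [rewrite rpredM|exact: mM|ring].
Qed.

(** The residue field is C: the monic equation of an integral element, reduced at [l0], splits over
    C, and as [m] is prime the element is congruent to one of the roots. Outside [Bint] the values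
    of [phi] are arbitrary, except that constants and [lam] are in [Bint]. *)
Lemma residue_map : exists phi : L -> C,
  [/\ {in Bint &, forall x y, phi (x + y) = phi x + phi y},
      {in Bint &, forall x y, phi (x * y) = phi x * phi y},
      forall k, phi (cst k) = k & phi lam = l0].
Proof.
have [m [mB ml m1 mD mM] mmax] := maximal_ideal.
have m0 : m 0 by rewrite -(mul0r (lam - cst l0)); apply: mM; rewrite ?rpred0.
have mN x : m x -> m (- x).
  by move=> mx; rewrite -mulN1r; apply: mM; rewrite // rpredN rpred1.
have mprime x y : x \in Bint -> y \in Bint -> m (x * y) -> m x \/ m y.
  move=> xB yB mxy; have [mx|nmx] := pselect (m x); [by left|right].
  have [z zB mz] := mmax _ xB nmx.
  have -> : y = y * (1 - z * x) + z * (x * y) by ring.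
  by apply: mD; apply: mM.
have emb_res a : m (emb a - cst a.[l0]).
  elim/poly_ind: a => [|a k IH]; first by rewrite horner0 !rmorph0 subr0.
  rewrite hornerMXaddC !rmorphD !rmorphM /= [emb 'X]evX [emb k%:P]evC.
  have -> : emb a * lam + cst k - (cst a.[l0] * cst l0 + cst k) =
    lam * (emb a - cst a.[l0]) + cst a.[l0] * (lam - cst l0) by ring.
  by apply: mD; apply: mM; rewrite ?Bint_lam ?Bint_cst.
have res x : exists k, x \in Bint -> m (x - cst k).
  have [|] := boolP (x \in Bint); last by exists 0.
  move=> xB; have /BintP[q mq /rootP rq] := xB.
  pose q0 := map_poly (horner_eval l0) q.
  have mq0 : q0 \is monic by rewrite monic_map.
  (* Replacing the coefficients of [q] by their values at [l0] changes the value [q(x) = 0] only by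
     an element of [m]. *)
  have : m (map_poly cst q0).[x].
    rewrite -[_.[x]]opprK; apply: mN; rewrite -(add0r (- _)) -rq /q0.
    elim/poly_ind: (q) => [|a k IH]; first by rewrite !rmorph0 !horner0 subr0.
    rewrite !rmorphD !rmorphM /= !map_polyX !map_polyC !hornerMXaddC /=.
    have -> : forall u v w z : L,
        u * x + v - (w * x + z) = x * (u - w) + (v - z).
      by move=> *; ring.
    by apply: mD; [apply: mM|apply: emb_res].
  have [s ->] := closed_field_poly_normal q0.
  rewrite (monicP mq0) scale1r rmorph_prod horner_prod.
  elim: s => [|k s IH]; first by rewrite big_nil => /m1.
  rewrite big_cons => /mprime[||mx|/IH //].
  - by rewrite rmorphB /= map_polyX map_polyC !hornerE rpredB // Bint_cst.
  - rewrite rpred_prod // => k' _.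
    by rewrite rmorphB /= map_polyX map_polyC !hornerE rpredB // Bint_cst.
  by exists k; move: mx; rewrite rmorphB /= map_polyX map_polyC !hornerE.
have /choice[phi phiP] := res.
(* Two constants congruent modulo [m] are equal, since a nonzero constant is a unit. *)
have phiE x k : x \in Bint -> m (x - cst k) -> phi x = k.
  move=> xB mk; apply/eqP; rewrite -subr_eq0; apply/negP=> /negP d0.
  apply: m1; rewrite -(rmorph1 cst) -(mulVf d0) rmorphM.
  apply: mM; first exact: Bint_cst.
  have -> : cst (phi x - k) = (x - cst k) - (x - cst (phi x)).
    by rewrite rmorphB; ring.
  by apply: mD => //; apply/mN/phiP.
exists phi; split=> [x y xB yB|x y xB yB|k|].
- apply: phiE; first by rewrite rpredD.
  have -> : x + y - cst (phi x + phi y) = (x - cst (phi x)) + (y - cst (phi y)).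
    by rewrite rmorphD; ring.
  by apply: mD; apply: phiP.
- apply: phiE; first by rewrite rpredM.
  have -> : x * y - cst (phi x * phi y) =
      y * (x - cst (phi x)) + cst (phi x) * (y - cst (phi y)).
    by rewrite rmorphM; ring.
  by apply: mD; apply: mM; rewrite ?Bint_cst //; apply: phiP.
- by apply: phiE; rewrite ?subrr ?Bint_cst.
- by apply: phiE; rewrite ?Bint_lam.
Qed.

End Residue.

(** * Transitivity *)

Section Roots.

Variable rs : seq L.
Hypotheses (splitL : splittingFieldFor 1%AS Ptri {:L}%AS) (uniq_rs : uniq rs)
  (rootsE : forall r, (r \in rs) = root Ptri r).
Let G := 'Gal({:L} / 1)%g.

Lemma factor_neq0 (r : L) (a b : nat) : r \in rs -> (0 < a)%N ->
  a%:R * r - b%:R != 0.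
Proof.
rewrite rootsE => Pr a0;
  have a0' : (a%:R : C) != 0 by rewrite Num.Theory.pnatr_eq0 -lt0n.
rewrite subr_eq0; apply/eqP => e; apply: (root_trans Pr (k := b%:R / a%:R)).
rewrite rmorphM fmorphV !rmorph_nat -e mulrC mulKf //.
by rewrite -(rmorph_nat cst) fmorph_eq0.
Qed.

Lemma deriv_Ptri_neq0 r : r \in rs -> Ptri^`().[r] != 0.
Proof.
move=> rrs; have Pr : root Ptri r by rewrite -rootsE.
suff : Ptri^`().[r] * r != 0 by rewrite mulf_eq0 negb_or => /andP[].
rewrite deriv_Ptri_root // mulf_neq0 ?expf_neq0 ?root_add1_neq0 //.
by rewrite factor_neq0 ?subn_gt0.
Qed.

(** The roots are transcendental over C, hence not critical points; being simple, they form a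
    duplicate-free list, which is [rs] up to order. *)
Lemma Ptri_prod : Ptri = \prod_(z <- rs) ('X - z%:P).
Proof.
have [s eP _] := splitL.
have {}eP : Ptri = \prod_(z <- s) ('X - z%:P).
  by apply/eqP; rewrite -eqp_monic ?monic_Ptri ?monic_prod_XsubC.
have rs_s : rs =i s by move=> z; rewrite rootsE eP root_prod_XsubC.
have us : uniq s.
  by apply: uniq_simple_roots => z; rewrite -rs_s -eP => /deriv_Ptri_neq0.
by rewrite eP; apply: perm_big; rewrite perm_sym uniq_perm.
Qed.

Lemma size_rs : size rs = n.
Proof. by have := size_Ptri; rewrite Ptri_prod size_prod_XsubC => -[]. Qed.

Lemma galois_L : galois 1 {:L}.
Proof.
apply/splitting_galoisField; exists Ptri; split=> //.
  rewrite rpredB ?rpredX ?rpredD ?polyOverX ?rpred1 //.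
  by rewrite polyOverZ ?polyOverX ?rpredX ?lam_mem1 // polyOverX.
by rewrite Ptri_prod separable_prod_XsubC.
Qed.

Lemma gal_mem1 g (x : L) : g \in G -> x \in 1%AS -> g x = x.
Proof. by move=> gG x1; apply: (fixed_gal _ gG) => //; apply: sub1v. Qed.

Lemma gal_emb g a : g \in G -> g (emb a) = emb a.
Proof. by move=> gG; rewrite (gal_mem1 gG) ?emb_mem1. Qed.

Lemma gal_cst g k : g \in G -> g (cst k) = cst k.
Proof. by move=> gG; rewrite (gal_mem1 gG) ?cst_mem1. Qed.

Lemma gal_lam g : g \in G -> g lam = lam.
Proof. by move=> gG; rewrite (gal_mem1 gG) ?lam_mem1. Qed.

Lemma gal_root g r : g \in G -> (g r \in rs) = (r \in rs).
Proof.
move=> gG; rewrite !rootsE !rootE !horner_Ptri -[RHS](fmorph_eq0 g).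
by rewrite rmorphB rmorphM !rmorphXn rmorphD rmorph1 /= gal_lam.
Qed.

Lemma gal_Bint g x : g \in G -> x \in Bint -> g x \in Bint.
Proof.
move=> gG /BintP[q mq /rootP rq]; apply/BintP; exists q => //; apply/rootP.
rewrite -(rmorph0 g) -rq -horner_map; congr (_.[_]).
by rewrite -map_poly_comp; apply: eq_map_poly => a /=; rewrite gal_emb.
Qed.

Lemma polyOver_emb (q : {poly L}) : q \is a polyOver Bint ->
  q \is a polyOver 1%AS -> exists q', q = map_poly emb q'.
Proof.
move=> /polyOverP qB /polyOverP q1.
have /choice[f fE] : forall i, exists a, q`_i = emb a.
  by move=> i; apply: Bint_mem1.
exists (\poly_(i < size q) f i); apply/polyP=> i.
rewrite coef_map coef_poly; case: ltnP => [_|hi]; first exact: fE.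
by rewrite /= rmorph0 nth_default.
Qed.

Lemma prod_XsubC_Bint (s : seq L) : {subset s <= rs} ->
  \prod_(z <- s) ('X - z%:P) \is a polyOver Bint.
Proof.
move=> srs; rewrite big_seq rpred_prod // => z /srs; rewrite rootsE => Pz.
by rewrite polyOverXsubC Bint_root.
Qed.

(* [Ptri] has degree 1 in [lam], so of two factors of it over [C[lam]] one
   has all its coefficients, hence all its roots, in [C]. *)
Lemma Ptri_irreducible (q1 q2 : {poly {poly C}}) :
  Ptri = map_poly emb q1 * map_poly emb q2 ->
  (forall r, r \in rs -> ~~ root (map_poly emb q1) r) \/
  (forall r, r \in rs -> ~~ root (map_poly emb q2) r).
Proof.
have embI : injective (map_poly emb)
  by apply: map_inj_poly (ev_inj lam_trans) (rmorph0 _).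
rewrite -rmorphM => eP.
pose P0 : {poly {poly C}} := ('X + 1) ^+ n - 'X *: 'X^p.
have /embI e : map_poly emb P0 = map_poly emb (q1 * q2).
  rewrite -eP rmorphB /= map_polyZ /= rmorphXn rmorphD /= rmorph1 !map_polyX.
  by rewrite map_polyXn /emb evX.
have : (size (swapXY P0) <= 2)%N.
  rewrite swapXY_trinomial.
  rewrite (leq_trans (size_polyD _ _)) // geq_max size_polyN.
  rewrite (leq_trans (size_polyC_leq1 _)) //=.
  by rewrite mul_polyC (leq_trans (size_scale_leq _ _)) // size_polyX.
(* A factor of degree 0 in [lam] has coefficients in C, so a root of it would be constant. *)
have cstroot q : (size (swapXY q) <= 1)%N -> forall r, r \in rs -> 
    q != 0 -> ~~ root (map_poly emb q) r.
  move=> /size1_polyC sq r; rewrite rootsE => Pr q0; apply/negP => /rootP rq.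
  have qE : q = map_poly polyC (swapXY q)`_0.
    by rewrite -[q in LHS]swapXYK sq swapXY_polyC coefC eqxx.
  move: rq q0; rewrite qE -map_poly_comp map_polyC_eq0.
  rewrite (@eq_map_poly _ _ _ cst) => [|k]; last exact: evC.
  by rewrite -evE => e0 q0; have [k /root_trans] := closed_root q0 e0.
have P0n0 : P0 != 0.
  by apply: contraTneq monic_Ptri => e0;
    rewrite eP -e e0 rmorph0 monicE lead_coef0 eq_sym oner_eq0.
move: P0n0; rewrite e mulf_eq0 negb_or => /andP[q10 q20].
have q10' : swapXY q1 != 0 by rewrite swapXY_eq0.
have q20' : swapXY q2 != 0 by rewrite swapXY_eq0.
rewrite rmorphM /= size_mul //.
rewrite (polySpred q10') (polySpred q20') addSn addnS ltnS /= => sz.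
case s1: (size (swapXY q1)).-1 => [|m].
  by left => r rrs; apply: cstroot => //; rewrite (polySpred q10') s1.
right => r rrs; apply: cstroot => //; rewrite (polySpred q20') ltnS.
by apply: leq_trans (leq_addl m _) _; rewrite -ltnS -addSn -s1.
Qed.

(** The minimal polynomial of [r] and its cofactor are products of some [X - z] with [z] in [rs], so
    their coefficients are integral and lie in C[lambda]. By irreducibility the cofactor has no root
    in [rs], so [s] is a conjugate of [r]. *)
Lemma gal_transitive r s : r \in rs -> s \in rs -> exists2 g, g \in G & g r = s.
Proof.
move=> rrs srs; suff : root (minPoly 1 r) s.
  apply: normalField_root_minPoly; rewrite ?memvf ?sub1v //.
  by have /and3P[] := galois_L.
have Pr : root Ptri r by rewrite -rootsE.
have P1 : Ptri \is a polyOver 1%AS.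
  rewrite rpredB ?rpredX ?rpredD ?polyOverX ?rpred1 //.
  by rewrite polyOverZ ?polyOverX ?rpredX ?lam_mem1 // polyOverX.
have /dvdpP[q qE] := minPoly_dvdp P1 Pr.
have : minPoly 1 r %| \prod_(z <- rs) ('X - z%:P).
  by rewrite -Ptri_prod qE dvdp_mulIr.
have q1 : q \is a polyOver 1%AS.
  have -> : q = Ptri %/ minPoly 1 r
    by rewrite qE mulpK ?monic_neq0 ?monic_minPoly.
  by rewrite divp_polyOver ?minPolyOver.
have mq : q \is monic
  by rewrite -(monicMl _ (monic_minPoly 1 r)) mulrC -qE monic_Ptri.
have : q %| \prod_(z <- rs) ('X - z%:P).
  by rewrite -Ptri_prod qE dvdp_mulIl.
move=> /dvdp_prod_XsubC[m1 e1] /dvdp_prod_XsubC[m2 e2].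
have {}e1 : q = \prod_(z <- mask m1 rs) ('X - z%:P).
  by apply/eqP; rewrite -eqp_monic ?monic_prod_XsubC.
have {}e2 : minPoly 1 r = \prod_(z <- mask m2 rs) ('X - z%:P).
  by apply/eqP; rewrite -eqp_monic ?monic_prod_XsubC ?monic_minPoly.
have [q1' q1E] : exists q', q = map_poly emb q'.
  by apply: polyOver_emb; rewrite // e1 prod_XsubC_Bint // => z /mem_mask.
have [q2' q2E] : exists q', minPoly 1 r = map_poly emb q'.
  by apply: polyOver_emb;
    rewrite ?minPolyOver // e2 prod_XsubC_Bint // => z /mem_mask.
have [h|h] := Ptri_irreducible (etrans qE (congr2 _ q1E q2E)); last first.
  by have := h r rrs; rewrite -q2E root_minPoly.
have := h s srs; rewrite -q1E => /negPf nq.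
by have := rootsE s; rewrite srs qE rootM nq /= => /esym.
Qed.

(** * A transposition *)

Section CriticalValue.

(* The critical point of [(x + 1)^n / x^p] other than [-1], and its value;
   locked because rewriting with [rmorphM] would unfold them. *)
Definition xcrit : C := locked (p%:R / (n - p)%:R).
Definition lcrit : C := locked ((xcrit + 1) ^+ n / xcrit ^+ p).

Lemma nat_neq0 m : (0 < m)%N -> m%:R != 0 :> C.
Proof. by rewrite Num.Theory.pnatr_eq0 -lt0n. Qed.

Lemma natnp : (n - p)%:R = n%:R - p%:R :> C.
Proof. by rewrite natrB // ltnW. Qed.

Lemma np_neq0 : n%:R - p%:R != 0 :> C.
Proof. by rewrite -natnp nat_neq0 ?subn_gt0. Qed.

Lemma xcrit_neq0 : xcrit != 0.
Proof. by rewrite /xcrit -lock mulf_neq0 ?invr_eq0 ?nat_neq0 ?subn_gt0. Qed.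

Lemma xcritE : xcrit + 1 = n%:R / (n - p)%:R.
Proof. by rewrite /xcrit -lock natnp; field; apply: np_neq0. Qed.

Lemma lcrit_neq0 : lcrit != 0.
Proof.
rewrite /lcrit -lock mulf_neq0 ?invr_eq0 ?expf_neq0 ?xcrit_neq0 // xcritE.
by rewrite mulf_neq0 ?invr_eq0 ?nat_neq0 ?subn_gt0 ?n_gt0.
Qed.

Lemma lcritE : lcrit * xcrit ^+ p = (xcrit + 1) ^+ n.
Proof. by rewrite /lcrit -lock divfK ?expf_neq0 ?xcrit_neq0. Qed.

Lemma natnp_xcrit : (n - p)%:R * xcrit = p%:R.
Proof. by rewrite /xcrit -lock mulrC divfK ?nat_neq0 ?subn_gt0. Qed.

Let Pbar : {poly C} := ('X + 1) ^+ n - lcrit *: 'X^p.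

Lemma horner_Pbar k : Pbar.[k] = (k + 1) ^+ n - lcrit * k ^+ p.
Proof. by rewrite !hornerE. Qed.

Section CriticalRoot.
Variable a : C.
Hypothesis Pa : root Pbar a.

Lemma Pbar_rootE : (a + 1) ^+ n = lcrit * a ^+ p.
Proof. by move/rootP/eqP: Pa; rewrite horner_Pbar subr_eq0 => /eqP. Qed.

Lemma Pbar_root_neq0 : a != 0.
Proof.
apply/eqP=> a0; have := Pbar_rootE.
rewrite a0 add0r expr1n expr0n (gtn_eqF p_gt0) mulr0.
by move/eqP; rewrite oner_eq0.
Qed.

Lemma Pbar_root_add1_neq0 : a + 1 != 0.
Proof.
have : (a + 1) ^+ n != 0.
  by rewrite Pbar_rootE mulf_neq0 ?lcrit_neq0 ?expf_neq0 ?Pbar_root_neq0.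
by rewrite expf_eq0 n_gt0.
Qed.

(** Comparing logarithmic derivatives of [(x + 1)^n] and [x^p] at [a]. The linear equation has the
    single solution [xcrit]. *)
Lemma Pbar_deriv_root : root Pbar^`() a -> n%:R * a = p%:R * (a + 1).
Proof.
move/rootP; rewrite derivB derivZ hornerD hornerN hornerZ => /eqP.
rewrite subr_eq0 => /eqP e.
have [dn _] := horner_deriv_Xadd1n n a; have [dp _] := horner_deriv_Xn p a.
apply: (mulfI (_ : (a + 1) ^+ n != 0)).
  by rewrite expf_neq0 ?Pbar_root_add1_neq0.
transitivity (n%:R * (a + 1) ^+ n * a); first by ring.
rewrite -dn e Pbar_rootE.
transitivity (lcrit * (p%:R * a ^+ p) * (a + 1)); last by ring.
by rewrite -dp; ring.
Qed.

(** With the previous equation, a vanishing second derivative would give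
    [p (a + 1)^2 (n - p) = 0]. *)
Lemma Pbar_deriv2_root : root Pbar^`() a -> ~~ root Pbar^`()^`() a.
Proof.
move/Pbar_deriv_root => ea; apply/rootP.
rewrite !(derivB, derivZ) hornerD hornerN hornerZ => /eqP.
rewrite subr_eq0 => /eqP e.
have [_ dn] := horner_deriv_Xadd1n n a; have [_ dp] := horner_deriv_Xn p a.
have a0 := Pbar_root_neq0; have a10 := Pbar_root_add1_neq0.
have {e dn dp} : (a + 1) ^+ n * (n%:R * (n%:R - 1) * a ^+ 2) =
   (a + 1) ^+ n * (p%:R * (p%:R - 1) * (a + 1) ^+ 2).
  transitivity (n%:R * (n%:R - 1) * (a + 1) ^+ n * a ^+ 2); first by ring.
  rewrite -dn e Pbar_rootE.
  transitivity (lcrit * (p%:R * (p%:R - 1) * a ^+ p) * (a + 1) ^+ 2);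
    last by ring.
  by rewrite -dp; ring.
move/(mulfI (expf_neq0 _ a10)) => e.
have : (n%:R - 1) * (n%:R * a) ^+ 2 = n%:R * (p%:R * (p%:R - 1) * (a + 1) ^+ 2).
  by rewrite -e; ring.
rewrite ea => {}e.
have : p%:R * (a + 1) ^+ 2 * (n%:R - p%:R) = 0.
  transitivity ((n%:R - 1) * (p%:R * (a + 1)) ^+ 2 -
    n%:R * (p%:R * (p%:R - 1) * (a + 1) ^+ 2)); first by ring.
  by rewrite e subrr.
by apply/eqP; rewrite !mulf_neq0 ?expf_neq0 ?nat_neq0 ?np_neq0.
Qed.

End CriticalRoot.

Variable phi : L -> C.
Hypotheses
  (phiD : {in Bint &, forall x y, phi (x + y) = phi x + phi y})
  (phiM : {in Bint &, forall x y, phi (x * y) = phi x * phi y})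
  (phi_cst : forall k, phi (cst k) = k) (phi_lam : phi lam = lcrit).

Lemma phi0 : phi 0 = 0. Proof. by rewrite -(rmorph0 cst) phi_cst. Qed.
Lemma phi1 : phi 1 = 1. Proof. by rewrite -(rmorph1 cst) phi_cst. Qed.

Lemma phiB : {in Bint &, forall x y, phi (x - y) = phi x - phi y}.
Proof.
move=> x y xB yB; have N1B : cst (-1) \in Bint by rewrite Bint_cst.
rewrite -mulN1r -(rmorph1 cst) -rmorphN phiD ?rpredM ?phiM //.
by rewrite phi_cst mulN1r.
Qed.

Lemma phi_emb a : phi (emb a) = a.[lcrit].
Proof.
elim/poly_ind: a => [|a k IH]; first by rewrite horner0 rmorph0 phi0.
rewrite hornerMXaddC !rmorphD rmorphM /= [emb 'X]evX [emb k%:P]evC.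
by rewrite phiD ?phiM ?IH ?phi_lam ?phi_cst ?rpredM ?Bint_emb ?Bint_lam
  ?Bint_cst.
Qed.

Lemma Bint_rs z : z \in rs -> z \in Bint.
Proof. by rewrite rootsE => Pz; apply: Bint_root. Qed.

(** Both sides are compared at each constant [k], as the image under [phi] of [Ptri.[cst k]],
    because [phi] respects the operations on [Bint] only. *)
Lemma Pbar_prod : Pbar = \prod_(z <- rs) ('X - (phi z)%:P).
Proof.
apply: poly_horner_inj => k; rewrite horner_Pbar horner_prod.
transitivity (phi (\prod_(z <- rs) (cst k - z))).
  have -> : \prod_(z <- rs) (cst k - z) = Ptri.[cst k].
    by rewrite Ptri_prod horner_prod; apply: eq_bigr => z _;
      rewrite hornerXsubC.
  rewrite horner_Ptri -(rmorph1 cst) -rmorphD -!rmorphXn.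
  by rewrite phiB ?phiM ?phi_cst ?phi_lam ?rpredM ?Bint_lam ?Bint_cst.
have : {subset rs <= Bint} by exact: Bint_rs.
elim: (rs) => [|z s IH] sB; first by rewrite !big_nil phi1.
have zB : z \in Bint by rewrite sB ?mem_head.
have {}sB : {subset s <= Bint} by move=> y ys; rewrite sB // in_cons ys orbT.
rewrite !big_cons phiM ?IH ?hornerXsubC ?phiB ?phi_cst ?rpredB ?Bint_cst //.
by rewrite big_seq rpred_prod // => y ys; rewrite rpredB ?Bint_cst ?sB.
Qed.

Lemma phi_root r : r \in rs -> root Pbar (phi r).
Proof.
by move=> rrs; rewrite Pbar_prod (big_rem r) //= rootM root_XsubC eqxx.
Qed.

Lemma phi_collision r s : r \in rs -> s \in rs -> r != s -> phi r = phi s ->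
  root Pbar^`() (phi r).
Proof.
move=> rrs srs rs' e; have srs' : s \in rem r rs.
  by rewrite mem_rem_uniq // inE eq_sym rs'.
rewrite Pbar_prod (big_rem r) //= (big_rem s) //= e mulrA -expr2.
by rewrite deriv_exp_XsubC_mul expr1 rootM root_XsubC eqxx.
Qed.

Lemma phi_no_triple r s t : r \in rs -> s \in rs -> t \in rs ->
  r != s -> r != t -> s != t -> phi r = phi s -> phi r = phi t -> False.
Proof.
move=> rrs srs trs rs' rt st e1 e2.
have /(Pbar_deriv2_root (phi_root rrs))/negP[] := phi_collision rrs srs rs' e1.
have srs' : s \in rem r rs by rewrite mem_rem_uniq // inE eq_sym rs'.
have trs' : t \in rem s (rem r rs).
  by rewrite mem_rem_uniq ?rem_uniq // inE eq_sym st /= mem_rem_uniq // inE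
    eq_sym rt.
rewrite Pbar_prod (big_rem r) //= (big_rem s) //= (big_rem t) //= -e1 -e2.
rewrite [_ * _](_ : _ =
  ('X - (phi r)%:P) ^+ 3 * \prod_(y <- rem t (rem s (rem r rs)))
  ('X - (phi y)%:P)); last by ring.
by rewrite !deriv_exp_XsubC_mul expr1 rootM root_XsubC eqxx.
Qed.

(** Serves to compute the products of [z], of [z + 1] and of [(n - p) z - p] over all roots. *)
Lemma prod_affine_rs (l k : C) :
  \prod_(z <- rs) (cst l * z - cst (l * k)) = cst ((- l) ^+ n) * Ptri.[cst k].
Proof.
rewrite -size_rs Ptri_prod horner_prod; elim: (rs) => [|z s IH].
  by rewrite !big_nil expr0 rmorph1 mulr1.
by rewrite !big_cons IH hornerXsubC exprS !rmorphM rmorphN; ring.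
Qed.

Lemma prod_rs : exists2 s, s != 0 & \prod_(z <- rs) z = cst s.
Proof.
exists ((-1) ^+ n); first by rewrite signr_eq0.
have := prod_affine_rs 1 0; rewrite horner_Ptri !rmorph0 add0r expr1n expr0n.
rewrite (gtn_eqF p_gt0) !mulr0 subr0 mulr1 => <-.
by apply: eq_bigr => z _; rewrite rmorph0 rmorph1 mul1r subr0.
Qed.

Lemma prod_rs_add1 : exists2 t, t != 0 & \prod_(z <- rs) (z + 1) = cst t * lam.
Proof.
exists ((-1) ^+ n * - (-1) ^+ p);
  first by rewrite mulf_neq0 ?oppr_eq0 ?signr_eq0.
have := prod_affine_rs 1 (-1); rewrite horner_Ptri rmorphN1 addNr expr0n.
rewrite (gtn_eqF n_gt0) sub0r => e.
transitivity (cst ((-1) ^+ n) * - (lam * (-1) ^+ p)).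
  by rewrite -e; apply: eq_bigr => z _;
    rewrite mulrN1 rmorphN rmorph1 mul1r opprK.
by rewrite rmorphM rmorphN !rmorphXn !rmorphN1; ring.
Qed.

Lemma prod_rs_crit : exists2 v, v != 0 &
  \prod_(z <- rs) ((n - p)%:R * z - p%:R) = cst v * (lam - cst lcrit).
Proof.
have np0 : (n - p)%:R != 0 :> C by rewrite nat_neq0 ?subn_gt0.
exists ((- (n - p)%:R) ^+ n * - xcrit ^+ p).
  by rewrite mulf_neq0 ?oppr_eq0 ?expf_neq0 ?xcrit_neq0 ?oppr_eq0.
have := prod_affine_rs (n - p)%:R xcrit; rewrite horner_Ptri => e.
transitivity (\prod_(z <- rs) (cst (n - p)%:R * z - cst ((n - p)%:R * xcrit))).
  by apply: eq_bigr => z _; rewrite natnp_xcrit !rmorph_nat.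
rewrite e; have -> : (cst xcrit + 1) ^+ n = cst lcrit * cst xcrit ^+ p.
  by rewrite -(rmorph1 cst) -rmorphD -!rmorphXn -lcritE rmorphM.
rewrite -[in LHS]rmorphXn; move: ((- _) ^+ n) (xcrit ^+ p) => A B.
by ring.
Qed.

(** [d] is the product of the differences of the roots, and its square is, up to sign, the product
    of the derivatives. The point is that [lam - cst lcrit] occurs to the first power. *)
Lemma disc_rs : exists d u, [/\ d \in Bint, u != 0 &
  d ^+ 2 = cst u * lam ^+ n.-1 * (lam - cst lcrit)].
Proof.
have [s s0 sE] := prod_rs; have [t t0 tE] := prod_rs_add1.
have [v v0 vE] := prod_rs_crit.
have DE : \prod_(z <- rs) Ptri^`().[z] =
    cst (t ^+ n.-1 * v / s) * lam ^+ n.-1 * (lam - cst lcrit).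
  (* Multiplying by the product [cst s] of the roots brings every derivative into the form of
     [deriv_Ptri_root]. *)
  apply: (mulIf (_ : cst s != 0)); first by rewrite fmorph_eq0.
  rewrite -{1}sE -big_split /=.
  transitivity (\prod_(z <- rs) ((z + 1) ^+ n.-1 * ((n - p)%:R * z - p%:R))).
    by rewrite big_seq [RHS]big_seq; apply: eq_bigr => z;
      rewrite rootsE => /deriv_Ptri_root.
  rewrite big_split /= prodrXl tE vE exprMn -rmorphXn.
  move: (t ^+ _) (lam ^+ _) (cst lcrit) => A B l; rewrite !rmorphM fmorphV.
  by field; rewrite fmorph_eq0.
pose r (i : 'I_(size rs)) := tnth (in_tuple rs) i.
have rD i : Ptri^`().[r i] = \prod_(j < size rs | j != i) (r i - r j).
  rewrite Ptri_prod big_tnth (bigD1 i) //= derivM derivXsubC mul1r.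
  rewrite hornerD hornerM hornerXsubC subrr mul0r addr0 horner_prod.
  by apply: eq_bigr => j _; rewrite hornerXsubC.
have [w w1 wE] := prod_diff_sqr r.
move: DE; rewrite big_tnth (eq_bigr _ (fun i _ => rD i)) wE => DE.
set d := \prod_i _ in DE; exists d, (w%:~R * (t ^+ n.-1 * v / s)).
have ww : w%:~R ^+ 2 = 1 :> L by rewrite -rmorphXn w1.
split.
- rewrite rpred_prod // => i _; rewrite rpred_prod // => j _.
  by rewrite rpredB ?Bint_rs ?mem_tnth.
- rewrite !mulf_neq0 ?invr_eq0 ?expf_neq0 //.
  by rewrite -sqrf_eq0 -rmorphXn w1 oner_eq0.
- transitivity (w%:~R * (w%:~R * d ^+ 2));
    first by rewrite mulrA -expr2 ww mul1r.
  by rewrite DE [cst (w%:~R * _)]rmorphM rmorph_int !mulrA.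
Qed.

(* The square of [E] below has nonzero reduction while [(d E)^2] vanishes to
   even order at [lcrit], so [d ^+ 2] would too, contrary to [disc_rs]. *)
Lemma inertia_nontrivial : exists g, [/\ g \in G, g != 1%g &
  forall b, b \in Bint -> phi (g b) = phi b].
Proof.
apply: contrapT => noI.
have {}noI g : g \in G -> g != 1%g ->
    exists2 b, b \in Bint & phi (g b) != phi b.
  move=> gG g1; apply: contrapT => nob; apply: noI; exists g; split=> // b bB.
  by apply/eqP/negPn/negP => db; apply: nob; exists b.
have [d [u [dB u0 dE]]] := disc_rs.
have d20 : d ^+ 2 != 0.
  rewrite dE !mulf_neq0 ?fmorph_eq0 ?expf_neq0 //.
    by apply/eqP => l00; apply: (@lam_trans 0); rewrite rmorph0.
  by rewrite subr_eq0; apply/eqP/lam_trans.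
have d0 : d != 0 by move: d20; rewrite expf_eq0.
have d21 : d ^+ 2 \in 1%AS.
  by rewrite dE !rpredM ?rpredX ?rpredB ?lam_mem1 ?cst_mem1.
(* The sign by which [g] acts on [d], well defined because [d ^+ 2] is fixed. *)
pose eps (g : gal_of {:L}) : C := if g d == d then 1 else -1.
have epsP g : g \in G -> g d = cst (eps g) * d.
  move=> gG; rewrite /eps; case: eqVneq => [->|nd];
    first by rewrite rmorph1 mul1r.
  have /eqP : (g d) ^+ 2 = d ^+ 2.
    transitivity (g (d ^+ 2)); first by rewrite rmorphXn.
    exact: gal_mem1.
  by rewrite eqf_sqr (negPf nd) /= => /eqP ->; rewrite rmorphN1 mulN1r.
have [e eB se] :
  exists2 e, e \in Bint & \sum_(g <- enum G) eps g * phi (g e) != 0.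
  apply: contrapT => noe.
  have sum0 x : x \in Bint -> \sum_(g <- enum G) eps g * phi (g x) = 0.
    by move=> xB; apply/eqP/negPn/negP => h; apply: noe; exists x.
  (* Dedekind's lemma would make all coefficients [eps g] vanish, whereas [eps 1 = 1]. *)
  suff /(_ 1%g) : {in enum G, forall g, eps g = 0}.
    rewrite mem_enum group1 /eps gal_id eqxx => /(_ isT)/eqP.
    by rewrite oner_eq0.
  apply: (@character_independence L C (gal_of {:L}) Bint
    (fun g x => phi (g x)) _ _ _ _ _ _ _ eps sum0).
  - exact: rpred1.
  - exact: rpredM.
  - exact: enum_uniq.
  - by move=> g _ /=; rewrite rmorph1 phi1.
  - move=> g; rewrite mem_enum => gG x y xB yB /=.
    by rewrite rmorphM phiM ?gal_Bint.
  - move=> g h; rewrite !mem_enum => gG hG gh.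
    have ghG : (g^-1 * h)%g \in G by rewrite groupM ?groupV.
    have gh1 : (g^-1 * h)%g != 1%g by rewrite -eq_mulVg1.
    have [b bB db] := noI _ ghG gh1.
    exists (g^-1%g b); first by rewrite gal_Bint ?groupV.
    rewrite -!galM ?memvf // mulVg gal_id eq_sym.
    exact: db.
pose E := \sum_(g <- enum G) cst (eps g) * g e.
have gB g : g \in G -> g e \in Bint by move=> gG; apply: gal_Bint.
have EB : E \in Bint.
  by rewrite /E big_seq rpred_sum // => g; rewrite mem_enum => gG;
    rewrite rpredM ?Bint_cst ?gB.
have phiE : phi E != 0.
  have gBe g : g \in enum G -> cst (eps g) * g e \in Bint.
    by rewrite mem_enum => gG; rewrite rpredM ?Bint_cst ?gB.
  suff -> : phi E = \sum_(g <- enum G) eps g * phi (g e) by [].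
  have : {subset enum G <= G} by move=> g; rewrite mem_enum.
  rewrite /E; elim: (enum G) => [|g s IH] sG; first by rewrite !big_nil phi0.
  have gG : g \in G by rewrite sG ?mem_head.
  have {}sG : {subset s <= G} by move=> h hs; rewrite sG // in_cons hs orbT.
  rewrite !big_cons phiD ?IH // ?rpredM ?Bint_cst ?gB //.
    by rewrite phiM ?phi_cst ?Bint_cst ?gB.
  rewrite big_seq rpred_sum // => h hs.
  by rewrite rpredM ?Bint_cst ?gB ?sG.
have dE1 : d * E \in 1%AS.
  (* The two signs combine, so that [d * E] is a trace and thus lies in C(lambda). *)
  have -> : d * E = galTrace 1 {:L} (d * e).
    rewrite /E mulr_sumr /galTrace big_enum /=; apply: eq_bigr => g gG.
    by rewrite rmorphM /= epsP // mulrCA mulrA.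
  have /galois_fixedField <- := galois_L.
  by rewrite galTrace_fixedField ?memvf.
have E21 : E ^+ 2 \in 1%AS.
  have -> : E ^+ 2 = (d * E) ^+ 2 / d ^+ 2 by rewrite exprMn mulrC mulKf.
  by rewrite rpredM ?rpredV // rpredX.
have [a aE] : exists a, d * E = emb a by apply: Bint_mem1 dE1; rewrite rpredM.
have [q qE] : exists q, E ^+ 2 = emb q by apply: Bint_mem1 E21; rewrite rpredX.
have q0 : q.[lcrit] != 0 by rewrite -phi_emb -qE expr2 phiM // mulf_neq0.
have key : a ^+ 2 = u%:P * 'X^(n.-1) * ('X - lcrit%:P) * q.
  apply: (ev_inj lam_trans);
    rewrite -[ev cst lam]/emb rmorphXn -aE exprMn dE qE.
  by rewrite 3!rmorphM rmorphB (rmorphXn emb) embX !embC.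
have : root a lcrit.
  have : root (a ^+ 2) lcrit by rewrite key !rootM root_XsubC eqxx orbT.
  by rewrite expr2 rootM orbb.
move=> /factor_theorem[a' a'E]; move: key; rewrite a'E => key.
have Xl0 : 'X - lcrit%:P != 0 :> {poly C} by rewrite polyXsubC_eq0.
(* One factor [X - lcrit] is cancelled; the left side still vanishes at [lcrit], the right side does
   not. *)
have /(mulfI Xl0) : ('X - lcrit%:P) * (('X - lcrit%:P) * a' ^+ 2) =
  ('X - lcrit%:P) * (u%:P * 'X^(n.-1) * q).
  transitivity ((a' * ('X - lcrit%:P)) ^+ 2); first by ring.
  by rewrite key; ring.
move/(congr1 (horner^~ lcrit))/eqP; rewrite hornerM hornerXsubC subrr mul0r.
rewrite !hornerM hornerC hornerXn eq_sym.
by rewrite !mulf_eq0 (negPf u0) (negPf q0) expf_eq0 (negPf lcrit_neq0) andbF.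
Qed.

Lemma gal_fix_rs g : g \in G -> (forall r, r \in rs -> g r = r) -> g = 1%g.
Proof.
move=> gG fr; have [s eP sL] := splitL.
have srs z : z \in s -> g z = z.
  by move=> zs; apply: fr; rewrite rootsE (eqp_root eP) root_prod_XsubC.
apply/eqP/gal_eqP => x _; rewrite gal_id.
have : x \in fixedField [set g].
  suff : (<<1 & s>> <= fixedField [set g])%VS.
    by move/subvP; apply; rewrite sL memvf.
  apply/Fadjoin_seqP; split; first exact: sub1v.
  move=> z zs; apply/fixedFieldP; rewrite ?memvf // => h; rewrite inE => /eqP->.
  exact: srs.
by move/mem_fixedFieldP => [_]; apply; rewrite inE.
Qed.

(** A root moved by [g] collides with its image under [phi], so it reduces to the critical point;
    since no three roots do, [g] moves only two. *)
Lemma gal_transposition_phi :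
  exists g r s, [/\ g \in G, [/\ r \in rs, s \in rs & r != s],
  g r = s, g s = r & forall t, t \in rs -> t != r -> t != s -> g t = t].
Proof.
have [g [gG g1 gphi]] := inertia_nontrivial.
have gI : injective g by apply: fmorph_inj.
have [r rrs gr] : exists2 r, r \in rs & g r != r.
  apply: contrapT => h; case/eqP: g1; apply: gal_fix_rs => // r rrs.
  by apply/eqP/negPn/negP => hr; apply: h; exists r.
have gs t : t \in rs -> g t \in rs by rewrite gal_root.
have Brs t : t \in rs -> phi (g t) = phi t by move=> /Bint_rs/gphi.
have critical t : t \in rs -> g t != t -> phi t = phi r.
  have crit y : y \in rs -> g y != y -> n%:R * phi y = p%:R * (phi y + 1).
    move=> yrs gy; apply: Pbar_deriv_root; first exact: phi_root.
    by apply: phi_collision (gs _ yrs) _ _; rewrite ?Brs // eq_sym.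
  move=> trs gt; have := crit _ trs gt; have := crit _ rrs gr => er et.
  apply: (mulfI np_neq0); rewrite !mulrBl er et; ring.
have fix_other t : t \in rs -> t != r -> t != g r -> g t = t.
  move=> trs tr tgr; apply/eqP/negPn/negP => gt.
  apply: (@phi_no_triple r (g r) t); rewrite ?gs ?Brs //.
  - by rewrite eq_sym.
  - by rewrite eq_sym.
  - by rewrite eq_sym.
  - by rewrite critical.
exists g, r, (g r); split=> //; first by rewrite gs ?rrs // eq_sym.
(* If [g (g r)] were not [r], it would be fixed by [g], and injectivity would give [g r = r]. *)
apply/eqP/negPn/negP => h; have := fix_other (g (g r)) _ h _.
rewrite !gs // (inj_eq gI) => /(_ isT gr)/gI/gI/eqP; by rewrite (negPf gr).
Qed.

End CriticalValue.

Lemma gal_transposition :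
  exists g r s, [/\ g \in G, [/\ r \in rs, s \in rs & r != s],
  g r = s, g s = r & forall t, t \in rs -> t != r -> t != s -> g t = t].
Proof.
have [phi [phiD phiM phi_cst phi_lam]] := residue_map lcrit.
exact: (gal_transposition_phi phiD phiM phi_cst phi_lam).
Qed.

(** * Blocks of roots *)

Section RationalFunctions.
Variable r : L.
Hypothesis rrs : r \in rs.
Let Pr : root Ptri r. Proof. by rewrite -rootsE. Qed.
Let trr := root_trans Pr.

Lemma ratfun_root_lam : ratfun cst r lam.
Proof.
exists (('X + 1) ^+ n), 'X^p; rewrite monic_neq0 ?monicXn //; split=> //.
by rewrite !rmorphXn rmorphD rmorph1 evX root_eqn // mulrC.
Qed.

Lemma ratfun_root_cst k : ratfun cst r (cst k).
Proof. by rewrite -(evC cst r); apply: ratfun_ev. Qed.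

Lemma ratfun_root_emb a : ratfun cst r (emb a).
Proof.
rewrite /emb evE; apply: ratfun_horner ratfun_root_lam => // i.
by rewrite coef_map; apply: ratfun_root_cst.
Qed.

Lemma ratfun_Fadjoin y : y \in <<1; r>>%VS -> ratfun cst r y.
Proof.
move=> /Fadjoin_polyP[q /polyOverP q1 ->]; apply: ratfun_horner => // [i|].
  have /mem1P[a [b [b0 e]]] := q1 i.
  have eb0 : emb b != 0 by rewrite ev_eq0 //; apply: lam_trans.
  have -> : q`_i = (emb b)^-1 * emb a by rewrite -e mulKf.
  by apply: ratfunM; [apply: ratfunV => //|]; apply: ratfun_root_emb.
by rewrite -[r in X in ratfun _ _ X](evX cst); apply: ratfun_ev.
Qed.

(** As a rational function of [r], [lam] has the denominator [r^p], so a power of [r] clears any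
    polynomial in [lam]. *)
Lemma clear_denom a : exists M a', ev cst r 'X^M * emb a = ev cst r a'.
Proof.
elim/poly_ind: a => [|a k [M [a' IH]]].
  by exists 0, 0; rewrite !rmorph0 mulr0.
exists (M + p)%N, (a' * ('X + 1) ^+ n + 'X^(M + p) * k%:P).
rewrite rmorphD rmorphM embX embC mulrDr !rmorphD !rmorphM evC.
congr (_ + _);
  rewrite -IH exprD rmorphM !rmorphXn rmorphD rmorph1 evX root_eqn //.
by ring.
Qed.

Lemma clear_denoms (q : {poly {poly C}}) :
  exists M, forall i, exists a, ev cst r 'X^M * emb q`_i = ev cst r a.
Proof.
elim/poly_ind: q => [|q a [M IH]].
  by exists 0%N => i; exists 0; rewrite coef0 !rmorph0 mulr0.
have [N [a' aE]] := clear_denom a; exists (M + N)%N => i.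
rewrite coefD coefMX coefC exprD rmorphM; case: i => [|i] /=.
  by rewrite add0r; exists ('X^M * a'); rewrite rmorphM -aE mulrA.
have [b bE] := IH i; exists ('X^N * b).
by rewrite addr0 rmorphM -bE; ring.
Qed.

(** The rational root theorem with [h] a power of X: an integral element of C(r) is a Laurent
    polynomial in [r]. *)
Lemma Bint_laurent y : y \in Bint -> ratfun cst r y ->
  exists N a, r ^+ N * y = ev cst r a.
Proof.
move=> /BintP[q mq rq] /(ratfun_coprime trr)[a [b [b0 cab e]]].
have [M MP] := clear_denoms q.
have : b %| ('X - 0%:P) ^+ M.
  apply: (rational_root_denom trr (monic_map _ mq) rq b0 cab e) => i.
  by rewrite subr0 coef_map; apply: MP.
move=> /dvdp_exp_XsubCP[N _];
  rewrite subr0 => /eqpP[[c1 c2] /andP[/= c10 c20] cE].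
exists N, ((c1 / c2) *: a).
have -> : r ^+ N = cst (c1 / c2) * ev cst r b.
  rewrite -(evC cst r) -rmorphM mul_polyC mulrC -scalerA cE scalerA mulVf //.
  by rewrite scale1r rmorphXn evX.
by rewrite -mulrA e -mul_polyC [ev _ _ (_ * _)]rmorphM evC.
Qed.

(** Both [y] and [w] are Laurent polynomials in [r] with product [t (r + 1)^n / r^p], so only X and
    X + 1 can divide the numerator of [y]. *)
Lemma lam_divisor y w t : y \in Bint -> w \in Bint -> ratfun cst r y ->
  t != 0 -> y * w = cst t * lam ->
  exists N j i k, [/\ k != 0, (i <= n)%N &
    r ^+ N * y = cst k * r ^+ j * (r + 1) ^+ i].
Proof.
move=> yB wB ry t0 yw.
have lam0 : lam != 0 by apply/eqP => h; apply: (@lam_trans 0); rewrite rmorph0.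
have y0 : y != 0.
  apply: contraNneq (_ : cst t * lam != 0) => [y0|];
    first by rewrite -yw y0 mul0r.
  by rewrite mulf_neq0 // fmorph_eq0.
have rw : ratfun cst r w.
  have -> : w = y^-1 * (cst t * lam) by rewrite -yw mulKf.
  apply: ratfunM => //; first exact: ratfunV.
  by apply: ratfunM => //; [apply: ratfun_root_cst|apply: ratfun_root_lam].
have [N [a aE]] := Bint_laurent yB ry; have [N' [a' a'E]] := Bint_laurent wB rw.
have key : a * (a' * 'X^p) = t%:P * 'X^(N + N') * ('X + 1) ^+ n.
  apply: (ev_inj trr);
    rewrite !rmorphM -aE -a'E evC !rmorphXn rmorphD rmorph1 evX.
  rewrite root_eqn // exprD.
  transitivity (r ^+ N * r ^+ N' * r ^+ p * (y * w)); first by ring.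
  by rewrite yw; ring.
have X10 : ('X + 1 : {poly C}) != 0
  by rewrite -size_poly_gt0 size_polyDl size_polyX ?size_poly1.
have a0 : a != 0.
  apply: contraNneq (_ : t%:P * 'X^(N + N') * ('X + 1) ^+ n != 0) => [a0|].
    by rewrite -key a0 mul0r.
  by rewrite !mulf_neq0 ?polyC_eq0 ?expf_neq0 ?polyX_eq0.
have [j [b]] := multiplicity_XsubC a 0; rewrite a0 subr0 /= => b0 abE.
have : b %| ('X - (-1)%:P) ^+ n.
  rewrite polyCN opprK -(@Gauss_dvdpr _ _ ('X^(N + N'))).
    rewrite -(dvdpZr _ _ t0) -mul_polyC mulrA -key abE -mulrA dvdp_mulr //.
  rewrite coprimep_expr // -['X]subr0 coprimep_XsubC //.
move=> /dvdp_exp_XsubCP[i ilen];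
  rewrite polyCN opprK => /eqpP[[c1 c2] /andP[/= c10 c20] cE].
exists N, j, i, (c2 / c1); split=> //; first by rewrite mulf_neq0 ?invr_eq0.
rewrite aE abE rmorphM rmorphXn evX.
have -> : b = (c2 / c1)%:P * ('X + 1) ^+ i.
  by rewrite mul_polyC mulrC -scalerA -cE scalerA mulVf ?scale1r.
by rewrite rmorphM evC rmorphXn rmorphD rmorph1 evX; ring.
Qed.

End RationalFunctions.

(** The equations of both roots give [(z X + 1)^n = z^p (X + 1)^n], as [r] is transcendental; at X =
    -1 this forces [z = 1]. *)
Lemma root_ratio_not_cst r r' z : r \in rs -> r' \in rs -> r' = cst z * r ->
  r' = r.
Proof.
rewrite !rootsE => Pr Pr' e.
have : (z%:P * 'X + 1) ^+ n = (z ^+ p)%:P * ('X + 1) ^+ n.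
  apply: (ev_inj (root_trans Pr)).
  transitivity ((r' + 1) ^+ n).
    by rewrite rmorphXn rmorphD rmorphM rmorph1 evC evX e.
  rewrite root_eqn // [RHS]rmorphM evC (rmorphXn (ev _ _)) rmorphD rmorph1 evX.
  by rewrite root_eqn // e exprMn (rmorphXn cst) mulrCA.
move/(congr1 (horner^~ (-1)))/eqP;
  rewrite hornerM !horner_exp !hornerD hornerM hornerX !hornerC.
rewrite addNr expr0n (gtn_eqF n_gt0) mulr0 expf_eq0 n_gt0 /= mulrN1 addrC
  subr_eq0 => /eqP z1.
by rewrite e -z1 rmorph1 mul1r.
Qed.

Lemma root_pow_neq r r' d : r \in rs -> r' \in rs -> (0 < d)%N ->
  r ^+ d = r' ^+ d -> r = r'.
Proof.
move=> rrs r'rs d0 e; have r0 : r != 0 by apply: root_neq0; rewrite -rootsE.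
have [||z zE] := @closed_root C L cst (r' / r) ('X^d - 1).
- by rewrite monic_neq0 // monicXnsubC.
- by rewrite rmorphB rmorphXn rmorph1 evX expr_div_n -e divff ?subrr ?expf_neq0.
by apply/esym/(root_ratio_not_cst (z := z)) => //; rewrite -zE divfK.
Qed.

(* The [n]-th powers of both equations read [x^U y^n = k^n lam^i x^V] for
   [x = r, r'], so [U = V] unless [r / r'] is a root of unity. *)
Lemma common_monomial r r' y N j i k : r \in rs -> r' \in rs -> r != r' ->
  k != 0 -> (i <= n)%N -> y != 0 ->
  r ^+ N * y = cst k * r ^+ j * (r + 1) ^+ i ->
  r' ^+ N * y = cst k * r' ^+ j * (r' + 1) ^+ i ->
  y = cst k \/ y = cst k * lam.
Proof.
move=> rrs r'rs nrr k0 ilen y0 e e'.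
have lam0 : lam != 0 by apply/eqP => h; apply: (@lam_trans 0); rewrite rmorph0.
pose U := (N * n)%N; pose V := (j * n + p * i)%N.
have pw x : x \in rs -> x ^+ N * y = cst k * x ^+ j * (x + 1) ^+ i ->
    x ^+ U * y ^+ n = cst k ^+ n * lam ^+ i * x ^+ V.
  rewrite rootsE => Px /(congr1 (fun z => z ^+ n));
    rewrite !exprMn -!exprM => ->.
  have -> : (x + 1) ^+ (i * n) = lam ^+ i * x ^+ (p * i).
    by rewrite mulnC exprM root_eqn // exprMn -exprM.
  by rewrite /V exprD; ring.
have := pw _ rrs e; have := pw _ r'rs e' => {pw} ur' ur.
have r0 : r != 0 by apply: root_neq0; rewrite -rootsE.
have r'0 : r' != 0 by apply: root_neq0; rewrite -rootsE.
have UV : r ^+ U * r' ^+ V = r' ^+ U * r ^+ V.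
  apply: (mulfI (_ : cst k ^+ n * lam ^+ i * y ^+ n != 0)).
    by rewrite !mulf_neq0 // expf_neq0 // fmorph_eq0.
  transitivity ((r ^+ U * y ^+ n) * (cst k ^+ n * lam ^+ i * r' ^+ V));
    first by ring.
  by rewrite ur -ur'; ring.
have eUV : U = V.
  apply/eqP; apply: contraNT nrr; rewrite neq_ltn => /orP[] lt.
    have d0 : (0 < V - U)%N by rewrite subn_gt0.
    apply/eqP/(root_pow_neq rrs r'rs d0).
    apply: (mulfI (_ : r ^+ U * r' ^+ U != 0));
      first by rewrite mulf_neq0 ?expf_neq0.
    rewrite mulrAC -exprD subnKC ?(ltnW lt) // -mulrA -exprD subnKC ?(ltnW lt)
      //.
    by rewrite UV mulrC.
  have d0 : (0 < U - V)%N by rewrite subn_gt0.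
  apply/eqP/(root_pow_neq rrs r'rs d0).
  apply: (mulfI (_ : r ^+ V * r' ^+ V != 0));
    first by rewrite mulf_neq0 ?expf_neq0.
  rewrite mulrAC -exprD subnKC ?(ltnW lt) // -mulrA -exprD subnKC ?(ltnW lt) //.
  by rewrite UV mulrC.
(* [N n = j n + p i] with [n] prime to [p]; together with [i <= n] this leaves [i = 0] or
   [i = n]. *)
have : (n %| i)%N.
  rewrite -(Gauss_dvdr _ coprime_np) -(dvdn_addr _ (dvdn_mull j (dvdnn n))).
  by rewrite -/V -eUV dvdn_mull.
case: (posnP i) => [i0 _|igt0 /(dvdn_leq igt0) nlei].
  left; have eN : N = j.
    by apply/eqP; rewrite -(eqn_pmul2r n_gt0) -/U eUV /V i0 muln0 addn0.
  move: e; rewrite i0 eN expr0 mulr1 mulrC; apply/mulIf.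
  by rewrite expf_neq0.
have {nlei ilen} ein : i = n by apply/eqP; rewrite eqn_leq ilen.
right; have eN : N = (j + p)%N.
  by apply/eqP; rewrite -(eqn_pmul2r n_gt0) -/U eUV /V ein mulnDl.
move: e; rewrite ein eN root_eqn -?rootsE // exprD => e.
apply: (mulfI (_ : r ^+ j * r ^+ p != 0));
  first by rewrite mulf_neq0 ?expf_neq0.
by rewrite e; ring.
Qed.

(** * The permutation group of the roots and the products over its blocks *)

Let T := seq_sub rs.
Let H : {set {perm T}} := Gal_perm rs.

Lemma Gal_permP (s : {perm T}) :
  reflect (exists2 g, g \in G & forall t, g (ssval t) = ssval (s t)) (s \in H).
Proof.
rewrite inE; apply: (iffP existsP) => [[g /andP[gG /forallP gs]]|[g gG gs]].
  by exists g => // t; apply/eqP.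
by exists g; rewrite gG; apply/forallP => t; rewrite gs.
Qed.

Lemma gal_perm g : g \in G -> exists2 s : {perm T}, s \in H &
  forall t, g (ssval t) = ssval (s t).
Proof.
move=> gG; have grs (t : T) : g (ssval t) \in rs by rewrite gal_root // ssvalP.
pose f t : T := SeqSub (grs t).
have fI : injective f.
  by move=> t u /(congr1 val) /= /fmorph_inj /val_inj.
exists (perm fI) => [|t]; last by rewrite permE.
by apply/Gal_permP; exists g => // t; rewrite permE.
Qed.

Fact Gal_perm_group : group_set H.
Proof.
apply/group_setP; split.
  by apply/Gal_permP; exists 1%g; rewrite ?group1 // => t; rewrite gal_id perm1.
move=> s u /Gal_permP[g gG gs] /Gal_permP[h hG hu]; apply/Gal_permP.
by exists (g * h)%g; rewrite ?groupM // => t;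
  rewrite galM ?memvf // gs hu permM.
Qed.
Let Hg := Group Gal_perm_group.

Lemma Gal_perm_tpermJ (s : {perm T}) t u : s \in H ->
  (tperm (s t) (s u) \in H) = (tperm t u \in H).
Proof. by move=> sH; rewrite -tpermJ -[H]/(gval Hg) groupJr. Qed.

(** For distinct roots, conjugation by [tperm u v] carries [tperm t v] to [tperm t u]. So being
    exchanged by a transposition of the group is an equivalence relation. *)
Lemma Gal_perm_tperm_trans t u v :
  tperm t u \in H -> tperm u v \in H -> tperm t v \in H.
Proof.
have [->|tv] := eqVneq t v; first by rewrite tperm1 -[H]/(gval Hg) group1.
have [->|tu] := eqVneq t u; first by [].
move=> tuH uvH; rewrite -(Gal_perm_tpermJ _ _ uvH) tpermR tpermD 1?eq_sym //.
Qed.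

(** The summand 1 matters: over all roots [z + 1] has product [lam] up to a constant, whereas [z]
    has a constant product. *)
Definition block_prod (t : T) : L :=
  \prod_(u : T | tperm t u \in H) (ssval u + 1).

Lemma gal_block_prod g (s : {perm T}) t : g \in G -> s \in H ->
  (forall u, g (ssval u) = ssval (s u)) -> g (block_prod t) = block_prod (s t).
Proof.
move=> gG sH gs;
  rewrite rmorph_prod /block_prod [RHS](reindex_inj (@perm_inj _ s)).
apply: eq_big => u; first by rewrite Gal_perm_tpermJ.
by move=> _; rewrite rmorphD rmorph1 /= gs.
Qed.

Lemma block_prod_tperm t u : tperm t u \in H -> block_prod t = block_prod u.
Proof.
move=> tu; apply: eq_bigl => v; apply/idP/idP;
  apply: Gal_perm_tperm_trans => //.
by rewrite tpermC.
Qed.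

Lemma prod_seq_sub (F : L -> L) :
  \prod_(t : T) F (ssval t) = \prod_(z <- rs) F z.
Proof.
rewrite -(big_map (@ssval _ rs) predT F); apply: perm_big;
  apply: uniq_perm => //.
  by rewrite map_inj_uniq ?index_enum_uniq //; apply: val_inj.
move=> z; apply/mapP/idP => [[t _ ->]|zrs]; first exact: ssvalP.
by exists (SeqSub zrs); rewrite ?mem_index_enum.
Qed.

Lemma seq_sub_transitive (t u : T) :
  exists g (s : {perm T}), [/\ g \in G, s \in H,
  (forall v, g (ssval v) = ssval (s v)) & s t = u].
Proof.
have [g gG gt] := gal_transitive (ssvalP t) (ssvalP u).
have [s sH gs] := gal_perm gG; exists g, s; split=> //.
by apply: val_inj; rewrite /= -gs.
Qed.

(** By transitivity, the one known transposition has a conjugate that moves [t]. *)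
Lemma block_nontrivial (t : T) : exists2 u, u != t & tperm t u \in H.
Proof.
have [g [r [s [gG [rrs srs rs'] gr gs gfix]]]] := gal_transposition.
pose r1 : T := SeqSub rrs; pose s1 : T := SeqSub srs.
have [x xH gx] := gal_perm gG.
have xE : x = tperm r1 s1.
  apply/permP => v; apply: val_inj; rewrite /= -gx;
    case: tpermP => [->|->|] //=.
  move=> /eqP v1 /eqP v2; apply: gfix; first exact: ssvalP.
    by apply: contra v1 => /eqP e; apply/eqP/val_inj.
  by apply: contra v2 => /eqP e; apply/eqP/val_inj.
have [_ [y [_ yH _ yt]]] := seq_sub_transitive r1 t.
exists (y s1); last by rewrite -yt Gal_perm_tpermJ // -xE.
by rewrite -yt (inj_eq perm_inj); apply: contra rs' => /eqP/(congr1 val)/= ->.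
Qed.

Lemma Bint_add1 (u : T) : ssval u + 1 \in Bint.
Proof. by rewrite rpredD ?rpred1 // Bint_root // -rootsE ssvalP. Qed.

Lemma block_prod_cst_lam t :
  exists k, block_prod t = cst k \/ block_prod t = cst k * lam.
Proof.
have [u ut tuH] := block_nontrivial t.
have [w w0 wE] := prod_rs_add1.
have split_prod : block_prod t *
    \prod_(u : T | tperm t u \notin H) (ssval u + 1) = cst w * lam.
  by rewrite -wE -(prod_seq_sub (fun z => z + 1)) [RHS](bigID
    (fun u => tperm t u \in H)).
have BB : block_prod t \in Bint by rewrite rpred_prod // => v _;
  apply: Bint_add1.
(* An automorphism fixing the root [t] preserves its block, so the block product lies in the field
   generated by [t]. *)
have rat : ratfun cst (ssval t) (block_prod t).
  apply: ratfun_Fadjoin; first exact: ssvalP.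
  have gal_t : galois <<1; ssval t>> {:L}.
    by apply: galoisS galois_L; rewrite subv_adjoin subvf.
  have /galois_fixedField <- := gal_t.
  apply/fixedFieldP; rewrite ?memvf // => g gt.
  have gG : g \in G.
    by apply: (fintype.subsetP (galS _ (subv_adjoin _ _))) gt.
  have [s sH gs] := gal_perm gG.
  rewrite (gal_block_prod _ gG sH gs); congr block_prod; apply: val_inj.
  by rewrite /= -gs (fixed_gal _ gt) ?memv_adjoin ?subvf.
have [|N [j [i [k [k0 ilen e]]]]] :=
  lam_divisor (ssvalP t) BB _ rat w0 split_prod.
  by rewrite rpred_prod // => v _; apply: Bint_add1.
exists k; apply: (common_monomial (ssvalP t) (ssvalP u) _ k0 ilen _ e).
- by rewrite eq_sym; apply: contra ut => /eqP/val_inj ->.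
- rewrite prodf_seq_neq0; apply/allP => v _; apply/implyP => _.
  by apply: root_add1_neq0; rewrite -rootsE ssvalP.
(* The automorphism exchanging [t] and [u] keeps the block product and turns the monomial equation
   for [t] into that for [u]. *)
have /Gal_permP[g gG gs] := tuH.
have := congr1 g e; rewrite !rmorphM !rmorphXn rmorphD rmorph1 /= gs tpermL.
by rewrite gal_cst // (gal_block_prod _ gG tuH gs) tpermL -(block_prod_tperm
  tuH).
Qed.

Lemma block_prod_const t u : block_prod t = block_prod u.
Proof.
have [g [s [gG sH gs <-]]] := seq_sub_transitive t u.
rewrite -(gal_block_prod _ gG sH gs) gal_mem1 //.
by have [k [->|->]] := block_prod_cst_lam t;
  rewrite ?rpredM ?cst_mem1 ?lam_mem1.
Qed.

Lemma tperm_Gal_perm t u : tperm t u \in H.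
Proof.
have [w w0 wE] := prod_rs_add1.
have lamU b l : b \in Bint -> l != 0 -> lam * b != cst l.
  by move=> bB l0; rewrite -[lam]subr0 -(rmorph0 cst) lam_cst_nonunit.
have prod_neq0 (v : T) : ssval v + 1 != 0.
  by apply: root_add1_neq0; rewrite -rootsE ssvalP.
have [k e] := block_prod_cst_lam t.
have k0 : k != 0.
  have : block_prod t != 0.
    by rewrite prodf_seq_neq0; apply/allP => v _; apply/implyP.
  by apply: contraNneq => k0; case: e => ->; rewrite k0 rmorph0 ?mul0r.
(* If block products are [k lam], two different blocks would make [lam ^+ 2] divide a constant
   multiple of [lam] in B. *)
case: e => e; last first.
  apply/negPn/negP => ntu.
  have : cst w * lam = cst (k ^+ 2) * lam ^+ 2 *
    \prod_(v : T | (tperm t v \notin H) && (tperm u v \notin H)) (ssval v + 1).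
    rewrite -wE -(prod_seq_sub (fun z => z + 1)) (bigID
      (fun v => tperm t v \in H)) /=.
    rewrite -/(block_prod t) (bigID (fun v => tperm u v \in H)) /=.
    rewrite (eq_bigl (fun v => tperm u v \in H)); last first.
      move=> v; case uv: (tperm u v \in H); rewrite ?andbF // andbT.
      by apply: contra ntu => tv; apply: Gal_perm_tperm_trans tv _;
        rewrite tpermC.
    by rewrite -/(block_prod u) -(block_prod_const t u) e rmorphXn; ring.
  set b := \prod_(v | _) _ => eb.
  have lam0 : lam != 0 by apply/eqP => h; apply: (@lam_trans 0);
    rewrite rmorph0.
  have bB : cst (k ^+ 2) * b \in Bint.
    by rewrite rpredM ?Bint_cst // rpred_prod // => v _; apply: Bint_add1.
  have /eqP[] := lamU _ _ bB w0; apply: (mulfI lam0).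
  by rewrite [RHS]mulrC eb; ring.
(* If block products are constant, so is their product over all [v]; but each block contains [v]
   itself, so this product is a multiple in B of that of all [z + 1], hence of [lam]. *)
have : \prod_(v : T) block_prod v = cst (k ^+ #|{: T}|).
  rewrite (eq_bigr (fun _ => cst k)) => [|v _];
    last by rewrite -(block_prod_const t v).
  by rewrite prodr_const rmorphXn.
pose rest v := \prod_(x : T | (tperm v x \in H) && (x != v)) (ssval x + 1).
have -> : \prod_(v : T) block_prod v = lam * (cst w * \prod_v rest v).
  rewrite mulrA [lam * _]mulrC -wE -(prod_seq_sub
    (fun z => z + 1)) -big_split /=.
  by apply: eq_bigr => v _;
    rewrite /block_prod (bigD1 v) //= tperm1 -[H]/(gval Hg) group1.
move/eqP; apply: contraTT => _; apply: lamU; last exact: expf_neq0.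
rewrite rpredM ?Bint_cst // rpred_prod // => v _; rewrite rpred_prod // => x _.
exact: Bint_add1.
Qed.

Lemma Gal_perm_full : H = [set: {perm T}].
Proof.
apply/setP => s; rewrite finset.in_setT; have [ts -> _] := prod_tpermP s.
by apply: (@group_prod _ Hg) => x _; apply: tperm_Gal_perm.
Qed.

End Roots.
End Trinomial.

Theorem theorem2 (R : realType) (n p : nat) (p_gt0 : (0 < p)%N)
    (p_lt_n : (p < n)%N) (coprime_np : coprime n p)
    (L : splittingFieldType {fraction {poly R[i]}})
    (splitL : splittingFieldFor 1%AS (map_poly (in_alg L) (trinomial R n p))
                {:L}%AS)
    (rs : seq L) (uniq_rs : uniq rs)
    (rootsE : forall r : L,
       (r \in rs) = root (map_poly (in_alg L) (trinomial R n p)) r) :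
  size rs = n /\ Gal_perm rs = [set: {perm seq_sub rs}].
Proof.
have PE : map_poly (in_alg L) (trinomial R n p) = Ptri n p L := Ptri_map n p L.
rewrite PE in splitL; have {}rootsE r : (r \in rs) = root (Ptri n p L) r.
  by rewrite rootsE PE.
split; first exact: (size_rs p_gt0 p_lt_n splitL uniq_rs rootsE).
exact: (Gal_perm_full p_gt0 p_lt_n coprime_np splitL uniq_rs rootsE).
Qed.
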